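(* Let $(\mathbb{N},d)$ and $(\mathbb{N},\partial)$ be uniformly locally finite metric spaces, and let $E$ and $F$ be Banach spaces with bases $\mathcal{E}$ and $\mathcal{F}$, respectively. Assume that $\mathcal{E}$ is $d$-symmetric, $\mathcal{F}$ is $\partial$-symmetric, and that all ghost idempotents in $\mathrm{B}_u(\partial,\mathcal{F})$ belong to $\mathrm{M}_\infty(\mathcal{F})$. If $\mathrm{B}_u(d,\mathcal{E})$ embeds as a Banach algebra onto a hereditary Banach subalgebra of $\mathrm{B}_u(\partial,\mathcal{F})$, then $(\mathbb{N},d)$ coarsely embeds into $(\mathbb{N},\partial)$.
   Context: All Banach spaces are complex, and ''basis'' means Schauder basis. For a basis $\mathcal{E}=(e_n)_n$ of $E$, $(e_n^* )_n$ denotes the biorthogonal functionals and $\mathcal{L}(E)$ the bounded operators on $E$. Given a metric $d$ on $\mathbb{N}$, $a\in\mathcal{L}(E)$ is a band operator (with respect to $\mathcal{E}$ and $d$) if there is $r>0$ such that $e_m^*(ae_n)=0$ whenever $d(n,m)>r$. $\mathrm{B}_u[d,\mathcal{E}]$ is the algebra of band operators, and the uniform Roe algebra $\mathrm{B}_u(d,\mathcal{E})$ is its operator-norm closure in $\mathcal{L}(E)$. A metric $d$ on $\mathbb{N}$ is uniformly locally finite if $\sup_{x}|B_r(x)|<\infty$ for all $r>0$ ($B_r(x)$ the closed $r$-ball). $\mathcal{E}$ is unconditional if there is $\lambda\ge1$ with $\|\sum_{n\le k}\alpha_ne_n\|\le\lambda\|\sum_{n\le k}\beta_ne_n\|$ for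 all $k$ and all scalars with $|\alpha_n|\le|\beta_n|$. An unconditional basis $\mathcal{E}$ is $d$-symmetric if for all $r>0$ and all bijections $\sigma:A\to B$ between subsets $A,B\subset\mathbb{N}$ with $d(i,\sigma(i))\le r$ for all $i\in A$, there is $C>0$ such that $C^{-1}\|\sum\alpha_ne_n\|\le\|\sum\alpha_ne_{\sigma(n)}\|\le C\|\sum\alpha_ne_n\|$ for all finitely supported scalar families $(\alpha_n)_{n\in A}$. An operator $a\in\mathcal{L}(E)$ is a ghost if for all $\varepsilon>0$ there is $n_0$ such that $|e_m^*(ae_n)|\le\varepsilon$ for all $n,m\ge n_0$; a ghost idempotent is a ghost $a$ with $a^2=a$. $\mathrm{M}_n(\mathcal{E})=\mathcal{L}(\mathrm{span}\{e_j: j\le n\})$, identified with $\{a\in\mathcal{L}(E): e_m^*(ae_k)=0\text{ whenever } m>n\text{ or }k>n\}$, and $\mathrm{M}_\infty(\mathcal{E})$ is the operator-norm closure of $\bigcup_n\mathrm{M}_n(\mathcal{E})$ in $\mathcal{L}(E)$. A Banach algebra embedding is an algebra homomorphism (not assumed unital) that is an isomorphism onto its image as a Banach space (bounded and bounded below). For Banach algebras $B\subset A$, $B$ is a hereditary subalgebra of $A$ if $BAB\subset B$. A map $f:(X,d)\to(Y,\partial)$ is a coarse embedding if it is coarse (for all $r>0$ there is $s>0$ such that $d(x,y)<r$ implies $\partial(f(x),f(y))<s$) and expanding (for all $s>0$ there is $r>0$ such that $d(x,y)>r$ implies $\partial(f(x),f(y))>s$). *)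

(* Defs.v *)
From HB Require Import structures.
From mathcomp Require Import all_boot all_order all_algebra.
From mathcomp Require Import all_classical all_reals all_analysis.
From mathcomp Require Import complex.

Set Implicit Arguments.
Unset Strict Implicit.
Unset Printing Implicit Defensive.

Import Order.TTheory GRing.Theory Num.Theory.
Import numFieldNormedType.Exports.

Local Open Scope classical_set_scope.
Local Open Scope ring_scope.
Local Open Scope complex_scope.

(* A complex Banach space is a completeNormedModType R[i] with R : realType, so
   norms and moduli are elements of R[i] (with zero imaginary part).  In the
   partial order of R[i], 0 < c and 1 <= c force c to be real; hence constants
   compared with norms may be taken in R[i]. *)

Section Metrics.
Context {R : realType}.
Implicit Types d del : nat -> nat -> R.

Record is_metric d : Prop := IsMetric {
  metric_ge0 : forall x y, 0 <= d x y;
  metric_eq0 : forall x y, d x y = 0 <-> x = y;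
  metric_symmetric : forall x y, d x y = d y x;
  metric_triangular : forall x y z, d x z <= d x y + d y z }.

Definition uniformly_locally_finite d : Prop :=
  forall r : R, 0 < r ->
    exists N : nat, forall x : nat, ([set y | (d x y <= r)%R] #<= `I_N)%card.

Definition coarse_map d del (f : nat -> nat) : Prop :=
  forall r : R, 0 < r -> exists2 s : R, 0 < s &
    forall x y, d x y < r -> del (f x) (f y) < s.

Definition expanding_map d del (f : nat -> nat) : Prop :=
  forall s : R, 0 < s -> exists2 r : R, 0 < r &
    forall x y, r < d x y -> s < del (f x) (f y).

Definition coarse_embedding d del (f : nat -> nat) : Prop :=
  coarse_map d del f /\ expanding_map d del f.

Definition coarsely_embeds d del : Prop :=
  exists f : nat -> nat, coarse_embedding d del f.

End Metrics.

Section Bases.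
Context {R : realType} {E : completeNormedModType R[i]}.
Implicit Types (e : nat -> E) (d : nat -> nat -> R).

Definition schauder_basis e : Prop :=
  forall x : E, exists! c : nat -> R[i],
    series (fun n => c n *: e n) @ \oo --> x.

(* The value at x of the m-th biorthogonal functional of the basis e
   (a junk value if e is not a basis). *)
Definition biorth e (m : nat) (x : E) : R[i] :=
  xget (fun=> 0) [set c : nat -> R[i] |
    series (fun n => c n *: e n) @ \oo --> x] m.

Definition unconditional_basis e : Prop :=
  schauder_basis e /\
  exists2 lam : R[i], 1 <= lam &
    forall (k : nat) (al be : nat -> R[i]),
      (forall n, (n <= k)%N -> `|al n| <= `|be n|) ->
      `|\sum_(n < k.+1) al n *: e n| <= lam * `|\sum_(n < k.+1) be n *: e n|.

(* The sums over A below are finitely supported sums (fsbigop). *)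
Definition symmetric_basis d e : Prop :=
  unconditional_basis e /\
  forall r : R, 0 < r ->
  forall (A B : set nat) (sigma : nat -> nat),
    set_bij A B sigma ->
    (forall i, A i -> d i (sigma i) <= r) ->
    exists2 C : R[i], 0 < C &
      forall al : nat -> R[i],
        finite_set [set n | A n /\ al n != 0] ->
        C^-1 * `|\sum_(n \in A) al n *: e n|
          <= `|\sum_(n \in A) al n *: e (sigma n)|
          <= C * `|\sum_(n \in A) al n *: e n|.

End Bases.

Section Operators.
Context {R : realType} {E : completeNormedModType R[i]}.
Implicit Types (e : nat -> E) (d : nat -> nat -> R).
Implicit Types (a b : E -> E) (S A B : set (E -> E)).

(* The algebra L(E) of bounded operators, as a set of functions: its linear
   structure is the pointwise one on E -> E and its product is composition. *)
Definition bounded_operators : set (E -> E) :=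
  [set a | linear a /\ continuous a].

Definition opnorm a : R :=
  sup [set complex.Re `|a x| | x in [set x : E | `|x| <= 1]].

Definition opclosure S : set (E -> E) :=
  [set a | bounded_operators a /\
    forall eps : R, 0 < eps -> exists2 b, S b & opnorm (a - b) < eps].

Definition band_operators d e : set (E -> E) :=
  [set a | bounded_operators a /\
    exists2 r : R, 0 < r &
      forall n m, r < d n m -> biorth e m (a (e n)) = 0].

Definition uniform_roe_algebra d e : set (E -> E) :=
  opclosure (band_operators d e).

Definition ghost e a : Prop :=
  bounded_operators a /\
  forall eps : R[i], 0 < eps -> exists n0 : nat, forall n m : nat,
    (n0 <= n)%N -> (n0 <= m)%N -> `|biorth e m (a (e n))| <= eps.

Definition ghost_idempotent e a : Prop := ghost e a /\ a \o a = a.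

Definition M_fin e (n : nat) : set (E -> E) :=
  [set a | bounded_operators a /\
    forall m k : nat, (n < m)%N \/ (n < k)%N -> biorth e m (a (e k)) = 0].

Definition M_infty e : set (E -> E) := opclosure (\bigcup_n M_fin e n).

Record banach_subalgebra B A : Prop := BanachSubalgebra {
  banach_subalgebra_sub : B `<=` A;
  banach_subalgebra0 : B 0;
  banach_subalgebraD : forall a b, B a -> B b -> B (a + b);
  banach_subalgebraZ : forall (k : R[i]) a, B a -> B (k *: a);
  banach_subalgebraM : forall a b, B a -> B b -> B (a \o b);
  banach_subalgebra_closed : opclosure B `<=` B }.

Definition hereditary_subalgebra B A : Prop :=
  banach_subalgebra B A /\
  forall b a b', B b -> A a -> B b' -> B (b \o a \o b').

End Operators.

Section Embeddings.
Context {R : realType} {E F : completeNormedModType R[i]}.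

(* Only the values of Phi on the Banach algebra A are constrained. *)
Record banach_algebra_embedding (A : set (E -> E)) (B : set (F -> F))
    (Phi : (E -> E) -> (F -> F)) : Prop := BanachAlgebraEmbedding {
  embedding_fun : forall a, A a -> B (Phi a);
  embeddingD : forall a b, A a -> A b -> Phi (a + b) = Phi a + Phi b;
  embeddingZ : forall (k : R[i]) a, A a -> Phi (k *: a) = k *: Phi a;
  embeddingM : forall a b, A a -> A b -> Phi (a \o b) = Phi a \o Phi b;
  embedding_bounded : exists2 C : R, 0 < C &
    forall a, A a -> opnorm (Phi a) <= C * opnorm a;
  embedding_bounded_below : exists2 c : R, 0 < c &
    forall a, A a -> c * opnorm a <= opnorm (Phi a) }.

Definition embeds_onto_hereditary (A : set (E -> E)) (B : set (F -> F)) : Prop :=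
  exists Phi : (E -> E) -> (F -> F),
    banach_algebra_embedding A B Phi /\ hereditary_subalgebra (Phi @` A) B.

End Embeddings.

(* Main.v *)
(* The hereditary embedding is spatially implemented, a -> U a V, by bounded
   operators U : E -> F and V : F -> E with V U = 1, and V B_u(del, F) U lies in
   B_u(d, E).  Hence Phi(e_(x,y)) = U e_x (x) e_y^* V, whose (k, m) entry is
   f_k^*(U e_x) e_y^*(V f_m).  The diagonal entries f_k^*(U e_x) e_x^*(V f_k) sum to
   1 over k; if their maxima over k were not bounded below uniformly in x, the
   idempotents Phi(e_(x,x)) could be cut down along a sparse sequence of x's to
   almost disjoint blocks that add up to a ghost idempotent in B_u(del, F) of
   infinite rank, against the hypothesis.  So some k(x) has a diagonal entry of
   modulus at least delta.  Exchanging factors, the (k(x), k(y)) entry of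
   Phi(e_(x,y)) is bounded below too; a gliding hump argument, where d-symmetry
   makes the partial translations bounded, then forces k(x) and k(y) to be
   uniformly close when x and y are.  The same argument with U and V exchanged
   shows that k is expanding.

   All this is done in normalised bases.  The ghost condition, however, is not
   invariant under normalisation; the blocks are therefore cut down further, to
   sets on which the norms of the f_k are essentially constant. *)

(* Small diagonal entries do not make a block small: if f_k^*(U e_x) e_x^*(V f_k) is at most eps^2
   for all k, nothing follows for f_k^*(U e_x) e_x^*(V f_m) with k different from m. But at every k
   one of the two factors is then at most eps, so keeping only indices where the same factor is
   small makes every entry of the block small. This and the other cuts leave a fixed share of the
   pairing e_x^*(V U e_x) = 1, and a bounded diagonal operator rescales the remainder to an
   idempotent.

   Back in the original basis an entry is multiplied by a quotient of norms of two f_k, and symmetry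
   bounds this quotient only at bounded distance. The sum of the blocks is close to a band operator,
   which cannot join indices whose norms differ by a large factor, whereas a rank one block joins
   everything in the support of its vector with everything seen by its functional. Hence vector and
   functional must meet in a window of norms of bounded ratio.

   Cutting functionals by projections stays inside the Roe algebra only for functionals in the
   closed span of the coordinate functionals, so this is shown for e_x^* V and f_k^* U
   beforehand. *)
From HB Require Import structures.
Require Import Defs.
From mathcomp Require Import all_boot all_order all_algebra.
From mathcomp Require Import all_classical all_reals all_analysis.
From mathcomp Require Import complex.
From mathcomp Require Import lra ring zify.

Set Implicit Arguments.
Unset Strict Implicit.
Unset Printing Implicit Defensive.

Import Order.TTheory GRing.Theory Num.Theory.
Import numFieldNormedType.Exports.

Local Open Scope classical_set_scope.
Local Open Scope ring_scope.
Local Open Scope complex_scope.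

(** * Real-valued norms and bounded operators *)

(** The order of [R[i]] is only partial; moving norms to [R] gives a total order in which case
    distinctions and [lra] work. *)
Definition rnorm (R : realType) (V : normedZmodType R[i]) (x : V) : R :=
  complex.Re `|x|.

Section RealNorm.
Context {R : realType}.

Lemma rnormE (V : normedZmodType R[i]) (x : V) : `|x| = (rnorm x)%:C.
Proof. by rewrite /rnorm RRe_real // normr_real. Qed.

Lemma rnorm_le (V W : normedZmodType R[i]) (x : V) (y : W) :
  (`|x| <= `|y|) = (rnorm x <= rnorm y).
Proof. by rewrite !rnormE lecR. Qed.

Lemma rnorm_ge0 (V : normedZmodType R[i]) (x : V) : 0 <= rnorm x.
Proof. by rewrite -lecR -rnormE normr_ge0. Qed.

Lemma rnorm0 (V : normedZmodType R[i]) : rnorm (0 : V) = 0.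
Proof. by rewrite /rnorm normr0. Qed.

Lemma rnorm_eq0 (V : normedZmodType R[i]) (x : V) : (rnorm x == 0) = (x == 0).
Proof.
by rewrite -[x == 0]normr_eq0 rnormE -(inj_eq (@complexI R)).
Qed.

Lemma rnorm_gt0 (V : normedZmodType R[i]) (x : V) : (0 < rnorm x) = (x != 0).
Proof. by rewrite lt_def rnorm_eq0 rnorm_ge0 andbT. Qed.

Lemma rnormN (V : normedZmodType R[i]) (x : V) : rnorm (- x) = rnorm x.
Proof. by rewrite /rnorm normrN. Qed.

Lemma rdistC (V : normedZmodType R[i]) (x y : V) : rnorm (x - y) = rnorm (y - x).
Proof. by rewrite /rnorm distrC. Qed.

Lemma rnormD (V : normedZmodType R[i]) (x y : V) :
  rnorm (x + y) <= rnorm x + rnorm y.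
Proof. by rewrite -lecR rmorphD /= -!rnormE ler_normD. Qed.

Lemma rnormB (V : normedZmodType R[i]) (x y : V) :
  rnorm (x - y) <= rnorm x + rnorm y.
Proof. by rewrite -(rnormN y) rnormD. Qed.

Lemma rnorm_sum (V : normedZmodType R[i]) (I : Type) (r : seq I) (P : pred I)
  (u : I -> V) : rnorm (\sum_(i <- r | P i) u i) <= \sum_(i <- r | P i) rnorm (u i).
Proof.
elim/big_rec2 : _ => [|i a b _ ab]; first by rewrite rnorm0.
by rewrite (le_trans (rnormD _ _))// lerD2l.
Qed.

Lemma rnormM (a b : R[i]) : rnorm (a * b) = rnorm a * rnorm b.
Proof. by apply: (@complexI R); rewrite rmorphM /= -!rnormE normrM. Qed.

Lemma rnorm1 : rnorm (1 : R[i]) = 1.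
Proof. by rewrite /rnorm normr1. Qed.

Lemma rnormV (a : R[i]) : rnorm a^-1 = (rnorm a)^-1.
Proof. by apply: (@complexI R); rewrite fmorphV /= -!rnormE normfV. Qed.

Lemma rnorm_real (r : R) : 0 <= r -> rnorm r%:C = r.
Proof.
by move=> r0; apply: (@complexI R); rewrite -rnormE ger0_norm// ler0c.
Qed.

Lemma rnormZ (V : normedModType R[i]) (a : R[i]) (x : V) :
  rnorm (a *: x) = rnorm a * rnorm x.
Proof. by apply: (@complexI R); rewrite rmorphM /= -!rnormE normrZ. Qed.

Lemma complex_gt0 (z : R[i]) : 0 < z -> exists2 r : R, 0 < r & z = r%:C.
Proof.
move=> z0; exists (complex.Re z); last by rewrite RRe_real// gtr0_real.
by move: z0; rewrite ltcE /= => /andP[].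
Qed.

Lemma cvg_rnormP (V : normedModType R[i]) (u : nat -> V) (l : V) :
  (u @ \oo --> l) <->
  (forall eps : R, 0 < eps ->
     exists N, forall n, (N <= n)%N -> rnorm (l - u n) < eps).
Proof.
split=> [/cvgrPdist_lt ul eps e0|ul].
  have /ul[N _ uN] : 0 < eps%:C by rewrite ltcR.
  by exists N => n /uN /=; rewrite rnormE ltcR.
apply/cvgrPdist_lt => eps /complex_gt0[r r0 ->].
have [N uN] := ul _ r0.
by exists N => // n /uN /=; rewrite rnormE ltcR.
Qed.

Lemma cvg_rnorm_unique (V : normedModType R[i]) (u : nat -> V) (l m : V) :
  u @ \oo --> l -> u @ \oo --> m -> l = m.
Proof. by move=> ul um; exact: (@cvg_unique _ _ (u @ \oo)). Qed.

Lemma cauchy_rnorm_cvg (V : completeNormedModType R[i]) (u : nat -> V) :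
  (forall eps : R, 0 < eps -> exists N, forall m n,
     (N <= m)%N -> (m <= n)%N -> rnorm (u n - u m) < eps) ->
  exists l : V, u @ \oo --> l.
Proof.
move=> uC; suff : cauchy ((u @ \oo) : set_system V).
  by move=> /cauchy_cvgP uc; exists (lim ((u @ \oo) : set_system V)).
apply/cauchy_ballP => eps /complex_gt0[r r0 ->].
have [N uN] := uC _ r0.
pose A := u @` [set n | (N <= n)%N].
have uA : (u @ \oo) A by exists N => // n /= nN; exists n.
exists (A, A); first by split.
move=> [_ _] [/= [m mN <-] [n nN <-]]; rewrite -ball_normE /ball_ /= rnormE ltcR.
by have [mn|/ltnW nm] := leqP m n; [rewrite rdistC|]; apply: uN.
Qed.

Lemma cvg_norm_le (V : normedModType R[i]) (u : nat -> V) (l : V) (B : R) :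
  u @ \oo --> l -> (forall n, exists2 m, (n <= m)%N & rnorm (u m) <= B) ->
  rnorm l <= B.
Proof.
move=> /cvg_rnormP ul uB; apply/ler_addgt0Pr => eps /ul[N uN].
have [m Nm umB] := uB N.
by rewrite -(subrK (u m) l) (le_trans (rnormD _ _))// addrC lerD// ltW// uN.
Qed.

End RealNorm.

Section BoundedLinear.
Context {R : realType}.

Definition bounded_by (E G : normedModType R[i]) (M : R) (A : E -> G) : Prop :=
  linear A /\ forall x, rnorm (A x) <= M * rnorm x.

Definition bl (E G : normedModType R[i]) (A : E -> G) : Prop :=
  exists M, bounded_by M A.

Implicit Types E F G : normedModType R[i].

Lemma bounded_by_bl E G M (A : E -> G) : bounded_by M A -> bl A.
Proof. by exists M. Qed.

Lemma bounded_byW E G M M' (A : E -> G) :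
  M <= M' -> bounded_by M A -> bounded_by M' A.
Proof.
move=> MM' [lA bA]; split=> // x.
by rewrite (le_trans (bA x))// ler_wpM2r// rnorm_ge0.
Qed.

Lemma bl_bound E G (A : E -> G) : bl A -> exists2 M, 1 <= M & bounded_by M A.
Proof.
move=> [M AM]; exists (Num.max 1 M); first by rewrite le_max lexx.
by apply: bounded_byW AM; rewrite le_max lexx orbT.
Qed.

Section Linear.
Context {E G : normedModType R[i]} {A : E -> G} (blA : bl A).

Let linA : linear A. Proof. by case: blA => M []. Qed.

Let Alin : {linear E -> G} := HB.pack A (GRing.isLinear.Build _ _ _ _ A linA).

Lemma bl0 : A 0 = 0. Proof. exact: (linear0 Alin). Qed.
Lemma blD x y : A (x + y) = A x + A y. Proof. exact: (linearD Alin). Qed.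
Lemma blB x y : A (x - y) = A x - A y. Proof. exact: (linearB Alin). Qed.
Lemma blZ k x : A (k *: x) = k *: A x. Proof. exact: (linearZ_LR Alin). Qed.
Lemma bl_sum (I : Type) (r : seq I) (P : pred I) (u : I -> E) :
  A (\sum_(i <- r | P i) u i) = \sum_(i <- r | P i) A (u i).
Proof. exact: (linear_sum Alin). Qed.

Lemma bl_cvg (u : nat -> E) l : u @ \oo --> l -> (A \o u) @ \oo --> A l.
Proof.
move=> /cvg_rnormP ul; apply/cvg_rnormP => eps e0.
have [M M1 [_ bA]] := bl_bound blA.
have M0 : 0 < M by lra.
have [N uN] := ul (eps / M) (divr_gt0 e0 M0).
exists N => n /uN lun; rewrite /= -blB (le_lt_trans (bA _))//.
by rewrite mulrC -ltr_pdivlMr.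
Qed.

End Linear.

Lemma bl_comp E F G (A : F -> G) (B : E -> F) : bl A -> bl B -> bl (A \o B).
Proof.
move=> blA blB'; have [M M1 [_ bA]] := bl_bound blA.
have [N N1 [_ bB]] := bl_bound blB'.
exists (M * N); split=> [k x y|x] /=.
  by rewrite (blD blB') (blZ blB') (blD blA) (blZ blA).
by rewrite (le_trans (bA _))// -mulrA ler_wpM2l//; lra.
Qed.

Lemma bl_add E G (A B : E -> G) : bl A -> bl B -> bl (A + B).
Proof.
move=> blA blB'; have [M M1 [_ bA]] := bl_bound blA.
have [N N1 [_ bB]] := bl_bound blB'.
exists (M + N); split=> [k x y|x] /=; rewrite !fctE.
  rewrite (blD blB') (blZ blB') (blD blA) (blZ blA) scalerDr.
  by rewrite addrACA.
by rewrite (le_trans (rnormD _ _))// mulrDl lerD.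
Qed.

Lemma bl_scale E G (k : R[i]) (A : E -> G) : bl A -> bl (k *: A).
Proof.
move=> blA; have [M M1 [_ bA]] := bl_bound blA.
exists (rnorm k * M); split=> [l x y|x]; rewrite !fctE.
  by rewrite (blD blA) (blZ blA) scalerDr !scalerA mulrC.
by rewrite rnormZ -mulrA ler_wpM2l// rnorm_ge0.
Qed.

Lemma bl_opp E G (A : E -> G) : bl A -> bl (- A).
Proof. by move=> /(bl_scale (-1)); rewrite scaleN1r. Qed.

Lemma bl_sub E G (A B : E -> G) : bl A -> bl B -> bl (A - B).
Proof. by move=> blA /bl_opp; apply: bl_add. Qed.

End BoundedLinear.

Section Opnorm.
Context {R : realType} {E : completeNormedModType R[i]}.
Implicit Types (a b : E -> E).

Lemma bounded_operatorsE a : bounded_operators a <-> bl a.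
Proof.
split=> [[la ca]|bla]; last first.
  split; first by case: bla => M [].
  move=> x; apply/cvgrPdist_lt => eps /complex_gt0[r r0 ->].
  have [M M1 [_ ba]] := bl_bound bla.
  have M0 : 0 < M by lra.
  have rM : 0 < (r / M)%:C :> R[i] by rewrite ltcR divr_gt0.
  near=> y; rewrite rnormE ltcR -(blB bla) (le_lt_trans (ba _))//.
  rewrite mulrC -ltr_pdivlMr// -ltcR -rnormE.
  by near: y; apply: (@cvgr_dist_lt _ _ _ (nbhs x) _ id) => //; exact: cvg_id.
have a0 : a 0 = 0.
  by have := la 1 0 0; rewrite !scale1r addr0 => /eqP; rewrite -subr_eq subrr => /eqP.
have aZ k x : a (k *: x) = k *: a x by have := la k x 0; rewrite a0 !addr0.
have /cvgrPdist_lt/(_ 1 ltr01) := ca 0.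
rewrite a0 => /nbhs_ballP[_ /complex_gt0[r r0 ->]] ra.
exists (2 / r); split=> // x.
have [->|x0] := eqVneq x 0; first by rewrite a0 !rnorm0 mulr0.
have nx0 : 0 < rnorm x by rewrite rnorm_gt0.
pose k : R[i] := (r / 2 / rnorm x)%:C.
have k0 : 0 < r / 2 / rnorm x by rewrite !divr_gt0.
have /ra : ball 0 r%:C (k *: x).
  rewrite -ball_normE /ball_ /= sub0r normrN rnormE ltcR rnormZ rnorm_real ?(ltW k0)//.
  by rewrite divfK ?gt_eqF//; lra.
rewrite /= sub0r normrN rnormE (_ : 1 = 1%:C)// ltcR aZ rnormZ.
rewrite rnorm_real ?(ltW k0)// => h.
have -> : rnorm (a x) = (2 / r * rnorm x) * (r / 2 / rnorm x * rnorm (a x)).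
  by field; rewrite !gt_eqF.
by rewrite ler_piMr ?ltW// mulr_gt0// divr_gt0.
Unshelve. all: by end_near. Qed.

Lemma opnorm_has_sup a : bl a ->
  has_sup [set complex.Re `|a x| | x in [set x : E | `|x| <= 1]].
Proof.
move=> bla; have [M M1 [_ ba]] := bl_bound bla.
split; first by exists (complex.Re `|a 0|), 0 => //=; rewrite normr0.
exists M => _ [x /= x1 <-]; rewrite (le_trans (ba _))//.
by rewrite ler_piMr//; [lra|rewrite -lecR -rnormE].
Qed.

Lemma opnorm_rnorm a x : bl a -> rnorm (a x) <= opnorm a * rnorm x.
Proof.
move=> bla; have [->|x0] := eqVneq x 0; first by rewrite (bl0 bla) !rnorm0 mulr0.
have nx0 : 0 < rnorm x by rewrite rnorm_gt0.
have i0 : 0 <= (rnorm x)^-1 by rewrite invr_ge0 ltW.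
rewrite -ler_pdivrMr// mulrC -{1}(rnorm_real i0) -rnormZ -(blZ bla).
apply: ub_le_sup; first by case: (opnorm_has_sup bla).
exists ((rnorm x)^-1%:C *: x) => //=.
by rewrite rnormE rnormZ rnorm_real// mulVf ?gt_eqF.
Qed.

Lemma opnorm_ge0 a : bl a -> 0 <= opnorm a.
Proof.
move=> bla; rewrite (le_trans (rnorm_ge0 (a 0)))//.
apply: ub_le_sup; first by case: (opnorm_has_sup bla).
by exists 0 => //=; rewrite normr0.
Qed.

Lemma opnorm_le a M : bl a -> 0 <= M -> (forall x, rnorm (a x) <= M * rnorm x) ->
  opnorm a <= M.
Proof.
move=> bla M0 ba; apply: ge_sup; first by case: (opnorm_has_sup bla).
move=> _ [x /= x1 <-]; rewrite (le_trans (ba _))//.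
by rewrite ler_piMr// -lecR -rnormE.
Qed.

Lemma opclosureP (S : set (E -> E)) a : (forall b, S b -> bl b) ->
  opclosure S a <-> bl a /\ forall eps : R, 0 < eps ->
    exists2 b, S b & forall x, rnorm (a x - b x) <= eps * rnorm x.
Proof.
move=> Sbl; split=> -[].
  move=> /bounded_operatorsE bla aS; split=> // eps /aS[b Sb ab].
  exists b => // x; have := opnorm_rnorm x (bl_sub bla (Sbl _ Sb)).
  by move=> /le_trans -> //; rewrite ler_wpM2r ?rnorm_ge0// ltW.
move=> bla aS; split=> [|eps e0]; first exact/bounded_operatorsE.
have e2 : 0 < eps / 2 by lra.
have [b Sb ab] := aS _ e2; exists b => //.
rewrite (@le_lt_trans _ _ (eps / 2))//; last lra.
by apply: opnorm_le => //; [exact: bl_sub bla (Sbl _ Sb)|lra].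
Qed.

End Opnorm.

(** * Normalised unconditional bases *)

Section Frames.
Context {R : realType}.

(* [C] bounds the coordinate functionals and the diagonal operators at once. *)
Record frame (E : completeNormedModType R[i]) (e : nat -> E)
    (c : nat -> E -> R[i]) (C : R) : Prop := Frame {
  frame_norm : forall n, rnorm (e n) = 1;
  frame_coord : forall n, bounded_by C (c n : E -> (R[i])^o);
  frame_delta : forall m n, c m (e n) = (m == n)%:R;
  frame_diag : forall (t : nat -> R[i]) (B : R), (forall n, rnorm (t n) <= B) ->
    exists2 D, bounded_by (C * B) D & forall n x, c n (D x) = t n * c n x;
  frame_exp : forall x, (fun N => \sum_(i < N) c i x *: e i) @ \oo --> x }.

Arguments frame_exp {E e c C} _ _ : rename.

(** Described by its coordinates, so that it does not depend on the bound [B] of [frame_diag]. For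
    bounded [t] the vector exists by [frame_diag] and is unique by [coord_inj]. *)
Definition diagop (E : completeNormedModType R[i]) (c : nat -> E -> R[i])
    (t : nat -> R[i]) (x : E) : E :=
  xget 0 [set y | forall n, c n y = t n * c n x].

Definition proj (E : completeNormedModType R[i]) (c : nat -> E -> R[i])
  (S : pred nat) : E -> E := diagop c (fun n => (S n)%:R).

Definition rank1 (E G : normedModType R[i]) (v : G) (phi : E -> R[i]) : E -> G :=
  fun x => phi x *: v.

Definition functional (E : normedModType R[i]) (M : R) (phi : E -> R[i]) : Prop :=
  bounded_by M (phi : E -> (R[i])^o).

Lemma functional_comp (E F : normedModType R[i]) M N (phi : F -> R[i]) (A : E -> F) :
  0 <= M -> functional M phi -> bounded_by N A -> functional (M * N) (phi \o A).
Proof.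
move=> M0 [lp bp] [lA bA]; split=> [k x y|x] /=; first by rewrite lA lp.
by rewrite (le_trans (bp _))// -mulrA ler_wpM2l.
Qed.

Lemma bl_rank1 (E G : normedModType R[i]) (v : G) M (phi : E -> R[i]) :
  functional M phi -> bl (rank1 v phi).
Proof.
move=> [lp bp]; exists (M * rnorm v); split=> [k x y|x]; rewrite /rank1.
  by rewrite lp scalerDl scalerA.
by rewrite rnormZ mulrAC ler_wpM2r// rnorm_ge0.
Qed.

(* The functionals in the closed span of the coordinate functionals. *)
Definition shrinking (E : completeNormedModType R[i]) (c : nat -> E -> R[i])
    (phi : E -> R[i]) : Prop :=
  forall eps : R, 0 < eps -> exists N0, forall N, (N0 <= N)%N -> forall x,
    rnorm (phi (proj c (fun n => N <= n)%N x)) <= eps * rnorm x.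

Section FrameTheory.
Context {E : completeNormedModType R[i]} {e : nat -> E} {c : nat -> E -> R[i]}.
Context {C : R} (fE : frame e c C).
Implicit Types (x y : E) (S T : pred nat).

Let blc n : bl (c n : E -> (R[i])^o).
Proof. exact: bounded_by_bl (frame_coord fE n). Qed.

Lemma coordD n x y : c n (x + y) = c n x + c n y. Proof. exact: (blD (blc n)). Qed.
Lemma coordB n x y : c n (x - y) = c n x - c n y. Proof. exact: (blB (blc n)). Qed.
Lemma coordZ n k x : c n (k *: x) = k * c n x. Proof. exact: (blZ (blc n)). Qed.
Lemma coord0 n : c n 0 = 0. Proof. exact: (bl0 (blc n)). Qed.
Lemma coord_sum n (I : Type) (r : seq I) (P : pred I) (u : I -> E) :
  c n (\sum_(i <- r | P i) u i) = \sum_(i <- r | P i) c n (u i).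
Proof. exact: (bl_sum (blc n)). Qed.
Lemma coord_le n x : rnorm (c n x) <= C * rnorm x.
Proof. by have [_] := frame_coord fE n; apply. Qed.

Lemma frame_const_ge1 : 1 <= C.
Proof.
by have := coord_le 0%N (e 0%N); rewrite (frame_delta fE) (frame_norm fE) mulr1 rnorm1.
Qed.

Lemma coord_inj x y : (forall n, c n x = c n y) -> x = y.
Proof.
move=> cxy; have := frame_exp fE y.
rewrite (_ : (fun N => _) = fun N => \sum_(i < N) c i x *: e i).
  exact: cvg_rnorm_unique (frame_exp fE x).
by apply/funext => N; apply: eq_bigr => i _; rewrite cxy.
Qed.

Lemma diagopE t B n x : (forall n, rnorm (t n) <= B) ->
  c n (diagop c t x) = t n * c n x.
Proof.
by move=> /(frame_diag fE)[D _ DE]; rewrite /diagop; case: xgetP => [y _ ->|/(_ (D x))[]].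
Qed.

Lemma diagop_bound t B : (forall n, rnorm (t n) <= B) ->
  bounded_by (C * B) (diagop c t).
Proof.
move=> tB; have [D DB DE] := frame_diag fE tB.
rewrite (_ : diagop c t = D)//; apply/funext => x; apply: coord_inj => n.
by rewrite (diagopE _ _ tB) DE.
Qed.

Lemma rnorm_nat_bool (b : bool) : rnorm (b%:R : R[i]) <= 1.
Proof. by case: b; rewrite ?rnorm0 ?rnorm1. Qed.

Lemma projE S n x : c n (proj c S x) = if S n then c n x else 0.
Proof.
rewrite /proj (@diagopE _ 1); last by move=> m; exact: rnorm_nat_bool.
by case: (S n); rewrite ?mul1r ?mul0r.
Qed.

Lemma proj_bound S : bounded_by C (proj c S).
Proof. by rewrite -[C]mulr1; apply: diagop_bound => n; exact: rnorm_nat_bool. Qed.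

Lemma proj_le S x : rnorm (proj c S x) <= C * rnorm x.
Proof. by have [_] := proj_bound S; apply. Qed.

Lemma bl_proj S : bl (proj c S). Proof. exact: bounded_by_bl (proj_bound S). Qed.

Lemma projI S T x : proj c S (proj c T x) = proj c (predI S T) x.
Proof.
by apply: coord_inj => n; rewrite !projE /=; case: (S n); case: (T n).
Qed.

Lemma eq_proj S T x : S =1 T -> proj c S x = proj c T x.
Proof. by move=> ST; apply: coord_inj => n; rewrite !projE ST. Qed.

Lemma projC S x : x = proj c S x + proj c (predC S) x.
Proof.
apply: coord_inj => n; rewrite coordD !projE /=.
by case: (S n); rewrite ?addr0 ?add0r.
Qed.

Lemma proj_basis S n : proj c S (e n) = if S n then e n else 0.
Proof.
apply: coord_inj => m; rewrite projE (fun_if (c m)) coord0 (frame_delta fE).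
by have [->|] := eqVneq m n; case: (S m); case: (S n).
Qed.

Lemma diagop_basis t B n : (forall n, rnorm (t n) <= B) ->
  diagop c t (e n) = t n *: e n.
Proof.
move=> tB; apply: coord_inj => m; rewrite (diagopE _ _ tB) coordZ (frame_delta fE).
by have [->|] := eqVneq m n; rewrite ?mulr0.
Qed.

Lemma proj_finE S N x : (forall n, S n -> (n < N)%N) ->
  proj c S x = \sum_(i < N | S i) c i x *: e i.
Proof.
move=> SN; apply: coord_inj => n; rewrite projE coord_sum.
under eq_bigr do rewrite coordZ (frame_delta fE).
case: ifPn => Sn.
  rewrite (bigD1 (Ordinal (SN _ Sn)))//= eqxx mulr1 big1 ?addr0// => i /andP[_ ni].
  by rewrite (_ : n == i = false) ?mulr0//; apply: contraNF ni => /eqP ni; apply/eqP/val_inj.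
rewrite big1// => i Si; rewrite (_ : n == i = false) ?mulr0//.
by apply: contraNF Sn => /eqP ->.
Qed.

Lemma proj_fin_le S N x : (forall n, S n -> (n < N)%N) ->
  rnorm (proj c S x) <= \sum_(i < N | S i) rnorm (c i x).
Proof.
move=> SN; rewrite (proj_finE _ SN) (le_trans (rnorm_sum _ _ _))//.
by apply: ler_sum => i _; rewrite rnormZ (frame_norm fE) mulr1.
Qed.

Lemma proj_tailE N x : proj c (fun n => N <= n)%N x = x - \sum_(i < N) c i x *: e i.
Proof.
have -> : \sum_(i < N) c i x *: e i = proj c (fun n => n < N)%N x.
  by rewrite (@proj_finE _ N)//; apply: eq_bigl => i; rewrite ltn_ord.
apply/eqP; rewrite eq_sym subr_eq [x in x == _](projC (fun n => n < N)%N) addrC; apply/eqP.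
by congr (_ + _); apply: eq_proj => n /=; rewrite -leqNgt.
Qed.

Lemma proj_tail_cvg0 x (eps : R) : 0 < eps -> exists N0, forall N, (N0 <= N)%N ->
  rnorm (proj c (fun n => N <= n)%N x) < eps.
Proof.
move=> e0; have /cvg_rnormP/(_ _ e0)[N0 NE] := frame_exp fE x.
by exists N0 => N /NE; rewrite proj_tailE.
Qed.

Lemma coord_cvg0 x (eps : R) : 0 < eps -> exists N0, forall N, (N0 <= N)%N ->
  rnorm (c N x) < eps.
Proof.
move=> e0; have C1 := frame_const_ge1; have C0 : 0 < C by lra.
have [N0 H] := proj_tail_cvg0 x (divr_gt0 e0 C0).
exists N0 => N /H; rewrite ltr_pdivlMr// mulrC; apply: le_lt_trans.
by have := coord_le N (proj c (fun n => N <= n)%N x); rewrite projE leqnn.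
Qed.

Lemma bl_coord_bound (G : normedModType R[i]) (A : E -> G) x B : bl A ->
  (forall N, \sum_(i < N) rnorm (c i x) * rnorm (A (e i)) <= B) ->
  rnorm (A x) <= B.
Proof.
move=> blA AB; apply: (cvg_norm_le (bl_cvg blA (frame_exp fE x))) => N.
exists N => //=; rewrite (bl_sum blA) (le_trans _ (AB N))// (le_trans (rnorm_sum _ _ _))//.
by apply: ler_sum => i _; rewrite (blZ blA) rnormZ.
Qed.

Lemma functional_coord_bound M (phi : E -> R[i]) x B : functional M phi ->
  (forall N, \sum_(i < N) rnorm (c i x) * rnorm (phi (e i)) <= B) ->
  rnorm (phi x) <= B.
Proof. by move=> /bounded_by_bl; exact: bl_coord_bound. Qed.

(** Every term of the expansion of [A x] is zero. With [A] a coordinate of a composite, this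
    replaces matrix multiplication by infinite sums. *)
Lemma bl_vanish (G : normedModType R[i]) (A : E -> G) x : bl A ->
  (forall i, c i x = 0 \/ A (e i) = 0) -> A x = 0.
Proof.
move=> blA A0; apply/eqP; rewrite -rnorm_eq0 eq_le rnorm_ge0 andbT.
apply: (bl_coord_bound blA) => N; rewrite big1// => i _.
by case: (A0 i) => ->; rewrite rnorm0 ?mul0r ?mulr0.
Qed.

Lemma functional_vanish M (phi : E -> R[i]) x : functional M phi ->
  (forall i, c i x = 0 \/ phi (e i) = 0) -> phi x = 0.
Proof. by move=> /bounded_by_bl; exact: bl_vanish. Qed.

Lemma bl_eq_basis (G : normedModType R[i]) (A B : E -> G) : bl A -> bl B ->
  (forall n, A (e n) = B (e n)) -> A = B.
Proof.
move=> blA blB' AB; apply/funext => x; apply/eqP; rewrite -subr_eq0; apply/eqP.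
by apply: (bl_vanish (bl_sub blA blB')) => i; right; rewrite !fctE AB subrr.
Qed.

Lemma functional_coord n : functional C (c n). Proof. exact: frame_coord fE n. Qed.

Lemma shrinking_coord n : shrinking c (c n).
Proof.
move=> eps e0; exists n.+1 => N nN x; rewrite projE leqNgt nN rnorm0.
by rewrite mulr_ge0 ?rnorm_ge0// ltW.
Qed.

Lemma shrinking_proj phi S : shrinking c phi -> shrinking c (phi \o proj c S).
Proof.
have C1 := frame_const_ge1; have C0 : 0 < C by lra.
move=> sp eps e0; have [N0 H] := sp _ (divr_gt0 e0 C0); exists N0 => N /H{}H x /=.
rewrite projI (eq_proj _ (T := predI (fun n => N <= n)%N S)); last first.
  by move=> n /=; rewrite andbC.
rewrite -projI (le_trans (H _))// -mulrA ler_pM2l// ler_pdivrMl//.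
exact: proj_le.
Qed.

Lemma shrinking_basis_cvg0 phi (eps : R) : shrinking c phi -> 0 < eps ->
  exists N0, forall N, (N0 <= N)%N -> rnorm (phi (e N)) <= eps.
Proof.
move=> sp /sp[N0 H]; exists N0 => N /H/(_ (e N)).
by rewrite proj_basis leqnn (frame_norm fE) mulr1.
Qed.

End FrameTheory.
End Frames.

(** * The uniform Roe algebra *)

Section HalfPowers.
Context {R : realType}.

Lemma half_pow_gt0 n : 0 < 2 ^- n :> R.
Proof. by rewrite invr_gt0 exprn_gt0. Qed.

Lemma half_powS n : 2 ^- n.+1 + 2 ^- n.+1 = 2 ^- n :> R.
Proof. by rewrite exprS invfM; lra. Qed.

Lemma half_pow_sum m n : \sum_(m <= i < n) 2 ^- i.+1 <= 2 ^- m :> R.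
Proof.
have [mn|/ltnW nm] := leqP m n; last by rewrite big_geq// ltW// half_pow_gt0.
rewrite (eq_big_nat _ _ (F2 := fun i => - 2 ^- i.+1 - - 2 ^- i)).
  by rewrite telescope_sumr// opprK addrC lerBlDr lerDl ltW// half_pow_gt0.
by move=> i _; rewrite opprK -(half_powS i); lra.
Qed.

Lemma half_pow_le m n : (m <= n)%N -> 2 ^- n <= 2 ^- m :> R.
Proof. by move=> mn; rewrite lef_pV2 ?posrE ?exprn_gt0// ler_weXn2l// ler1n. Qed.

Lemma half_pow_cvg0 (B eps : R) : 0 < eps -> exists n, B * 2 ^- n < eps.
Proof.
move=> e0; exists (Num.bound (`|B| / eps)).
set n := Num.bound _.
have nB : `|B| / eps < 2 ^+ n.
  apply: (lt_trans (archi_boundP _)); first by rewrite divr_ge0// ltW.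
  by rewrite -natrX ltr_nat ltn_expl.
rewrite ltr_pdivrMr ?exprn_gt0// (le_lt_trans (ler_norm B))//.
by rewrite mulrC -ltr_pdivrMr.
Qed.

End HalfPowers.

Section RoeAlgebra.
Context {R : realType} {E : completeNormedModType R[i]}.
Variables (d : nat -> nat -> R) (e : nat -> E) (c : nat -> E -> R[i]).
Context {C : R} (dm : is_metric d) (fE : frame e c C).
Implicit Types (a b : E -> E).

Definition band (r : R) a : Prop :=
  bl a /\ forall n m, r < d n m -> c m (a (e n)) = 0.

(** The pointwise estimate keeps the closure properties free of the supremum in [opnorm];
    [roe_normalised] links this to [uniform_roe_algebra]. *)
Definition roe a : Prop :=
  bl a /\ forall eps : R, 0 < eps -> exists r b,
    band r b /\ forall x, rnorm (a x - b x) <= eps * rnorm x.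

Lemma roe_bl a : roe a -> bl a. Proof. by case. Qed.

Lemma band_roe r a : band r a -> roe a.
Proof.
move=> ra; split=> [|eps e0]; first by case: ra.
by exists r, a; split=> // x; rewrite subrr rnorm0 mulr_ge0 ?rnorm_ge0// ltW.
Qed.

Lemma roe_approx a : bl a ->
  (forall eps : R, 0 < eps -> exists2 b, roe b &
     forall x, rnorm (a x - b x) <= eps * rnorm x) -> roe a.
Proof.
move=> bla H; split=> // eps e0.
have e2 : 0 < eps / 2 by lra.
have [b [_ /(_ _ e2)[r [b' [rb' bb']]]] ab] := H _ e2.
exists r, b'; split=> // x; rewrite -(subrK (b x) (a x)) -addrA.
rewrite (le_trans (rnormD _ _))//.
by rewrite (le_trans (lerD (ab x) (bb' x)))// -mulrDl; rewrite -splitr.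
Qed.

Lemma band_add r s a b : band r a -> band s b -> band (Num.max r s) (a + b).
Proof.
move=> [bla ra] [blb sb]; split; first exact: bl_add.
move=> n m; rewrite gt_max => /andP[rnm snm].
by rewrite fctE (coordD fE) ra// sb// addr0.
Qed.

Lemma roe_add a b : roe a -> roe b -> roe (a + b).
Proof.
move=> [bla ra] [blb rb]; split=> [|eps e0]; first exact: bl_add.
have e2 : 0 < eps / 2 by lra.
have [r [a' [ra' aa']]] := ra _ e2; have [s [b' [sb' bb']]] := rb _ e2.
exists (Num.max r s), (a' + b'); split; first exact: band_add.
move=> x; rewrite !fctE opprD addrACA (le_trans (rnormD _ _))//.
by rewrite (le_trans (lerD (aa' x) (bb' x)))// -mulrDl -splitr.
Qed.

Lemma roe_scale k a : roe a -> roe (k *: a).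
Proof.
move=> [bla ra]; split=> [|eps e0]; first exact: bl_scale.
have k0 : 0 < rnorm k + 1 by have := rnorm_ge0 k; lra.
have [r [a' [[bla' ra'] aa']]] := ra _ (divr_gt0 e0 k0).
exists r, (k *: a'); split.
  split=> [|n m nm]; first exact: bl_scale.
  by rewrite fctE (coordZ fE) ra'// mulr0.
move=> x; rewrite !fctE -scalerBr rnormZ.
apply: (@le_trans _ _ ((rnorm k + 1) * (eps / (rnorm k + 1) * rnorm x))).
  by apply: ler_pM; rewrite ?rnorm_ge0// lerDl.
by rewrite mulrA [_ * (eps / _)]mulrC divfK// gt_eqF.
Qed.

Lemma roe_sub a b : roe a -> roe b -> roe (a - b).
Proof. by move=> ra /(roe_scale (-1)); rewrite scaleN1r; exact: roe_add. Qed.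

Lemma roe_sum (u : nat -> E -> E) N : (forall n, roe (u n)) ->
  roe (\sum_(n < N) u n).
Proof.
move=> ru; elim: N => [|N IH]; last by rewrite big_ord_recr; exact: roe_add.
rewrite big_ord0 -(scale0r (u 0%N)); exact: roe_scale.
Qed.

Lemma band_comp r s a b : band r a -> band s b -> band (r + s) (a \o b).
Proof.
move=> [bla ra] [blb sb]; split=> [|n m nm]; first exact: bl_comp.
have [M M1 aM] := bl_bound bla.
apply: (functional_vanish fE (phi := c m \o a) (M := C * M)).
  apply: functional_comp aM; first by have := frame_const_ge1 fE; lra.
  exact: (functional_coord fE).
move=> i /=; have [rim|rim] := ltP r (d i m); first by right; rewrite ra.
left; apply: sb; rewrite ltNge; apply/negP => sni.
by have := metric_triangular dm n i m; lra.
Qed.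

Lemma roe_comp a b : roe a -> roe b -> roe (a \o b).
Proof.
move=> ra [blb rb]; have bla := roe_bl ra; case: ra => _ ra.
split=> [|eps e0]; first exact: bl_comp.
have [M M1 [_ aM]] := bl_bound bla; have [N N1 [_ bN]] := bl_bound blb.
have M0 : 0 < M by lra.
have N0 : 0 < N by lra.
have eM : 0 < eps / 2 / M by rewrite !divr_gt0.
(* [b'] is chosen before [a'], because the precision needed for [a'] depends on the bound [N'] of
   [b']. *)
have [s [b' [sb' bb']]] := rb _ eM.
have blb' : bl b' by case: sb'.
have [N' N'1 [_ bN']] := bl_bound blb'.
have N'0 : 0 < N' by lra.
have eN : 0 < eps / 2 / N' by rewrite !divr_gt0.
have [r [a' [ra' aa']]] := ra _ eN.
exists (r + s), (a' \o b'); split; first exact: band_comp.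
move=> x /=; rewrite -(subrK (a (b' x)) (a (b x))) -addrA.
rewrite (le_trans (rnormD _ _))// [eps]splitr mulrDl lerD//.
  rewrite -(blB bla) (le_trans (aM _))// -ler_pdivlMl// (le_trans (bb' x))//.
  by rewrite mulrA [M^-1 * _]mulrC.
rewrite (le_trans (aa' _))// (le_trans (ler_wpM2l (ltW eN) (bN' x)))//.
by rewrite mulrA divfK// gt_eqF.
Qed.

Lemma band_diagop t B : (forall n, rnorm (t n) <= B) -> band 0 (diagop c t).
Proof.
move=> tB; split=> [|n m nm].
  exact: bounded_by_bl (diagop_bound fE tB).
rewrite (diagopE fE _ _ tB) (frame_delta fE).
have [mn|_] := eqVneq m n; last by rewrite mulr0.
by move: nm; rewrite mn (metric_eq0 dm n n).2 // ltxx.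
Qed.

Lemma roe_diagop t B : (forall n, rnorm (t n) <= B) -> roe (diagop c t).
Proof. by move=> /band_diagop; exact: band_roe. Qed.

Lemma roe_proj S : roe (proj c S).
Proof. by apply: (@roe_diagop _ 1) => n; exact: rnorm_nat_bool. Qed.

Lemma roe_id : roe idfun.
Proof.
suff -> : idfun = proj c xpredT by exact: roe_proj.
by apply/funext => x; apply: (coord_inj fE) => n; rewrite (projE fE).
Qed.

Lemma finite_roe a N : bl a -> (forall n, (N <= n)%N -> a (e n) = 0) ->
  (forall n m, (N <= m)%N -> c m (a (e n)) = 0) -> roe a.
Proof.
move=> bla aN cN.
(* The sum of all distances between indices below [N] dominates each of them, so it serves as
   propagation. *)
apply: (@band_roe (\sum_(i < N) \sum_(j < N) d i j)); split=> // n m.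
have [Nn|nN] := leqP N n; first by rewrite aN// (coord0 fE).
have [Nm|mN] := leqP N m; first by rewrite cN.
rewrite ltNge => /negP[]; rewrite (bigD1 (Ordinal nN))//= (bigD1 (Ordinal mN))//=.
rewrite -addrA lerDl addr_ge0//; repeat (apply: sumr_ge0 => ? _);
  by rewrite ?(metric_ge0 dm).
Qed.

(** Truncating both [v] and [phi] to finitely many coordinates gives a finite matrix. For [phi] this
    is an approximation in norm precisely because [phi] is shrinking. *)
Lemma roe_rank1 v M phi : functional M phi -> shrinking c phi ->
  roe (rank1 v phi).
Proof.
move=> fphi sphi; apply: roe_approx => [|eps e0]; first exact: bl_rank1 fphi.
have [_ phiM] := fphi.
have blphi : bl (phi : E -> (R[i])^o) by exact: bounded_by_bl fphi.
have C1 := frame_const_ge1 fE; have C0 : 0 < C by lra.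
pose M' := Num.max M 1.
have M'1 : 1 <= M' by rewrite le_max lexx orbT.
have M'0 : 0 < M' by lra.
have fphi' : functional M' phi by apply: bounded_byW fphi; rewrite le_max lexx.
have v0 : 0 < rnorm v + 1 by have := rnorm_ge0 v; lra.
have e1 : 0 < eps / 2 / (rnorm v + 1) by rewrite !divr_gt0.
have e2 : 0 < eps / 2 / (M' * C) by rewrite !divr_gt0// mulr_gt0.
have [N1 /(_ _ (leqnn _)) H1] := sphi _ e1.
have [N2 /(_ _ (leqnn _)) H2] := proj_tail_cvg0 fE v e2.
pose P1 := proj c (fun n => n < N1)%N.
have fP1 : functional (M' * C) (phi \o P1).
  by apply: functional_comp => //; [lra|exact: (proj_bound fE)].
exists (rank1 (proj c (fun n => n < N2)%N v) (phi \o P1)).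
  apply: (@finite_roe _ (maxn N1 N2)) => [|n|n m].
  - exact: bl_rank1 fP1.
  - rewrite geq_max => /andP[nN1 _]; rewrite /rank1 /= /P1 (proj_basis fE).
    by rewrite ltnNge nN1 /= (bl0 blphi) scale0r.
  - rewrite geq_max => /andP[_ nN2]; rewrite /rank1 (coordZ fE) (projE fE).
    by rewrite ltnNge nN2 mulr0.
move=> x; rewrite /rank1 /=.
rewrite -(subrK (phi (P1 x) *: v) (phi x *: v)) -addrA -scalerBl -scalerBr.
rewrite (le_trans (rnormD _ _))// [eps]splitr mulrDl lerD// rnormZ.
  rewrite {1}[x](projC fE (fun n => n < N1)%N) -/P1 (blD blphi) addrAC subrr add0r.
  rewrite (eq_proj fE _ (T := fun n => N1 <= n)%N); last by move=> n /=; rewrite -leqNgt.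
  apply: (@le_trans _ _ (eps / 2 / (rnorm v + 1) * rnorm x * (rnorm v + 1))).
    by apply: ler_pM; rewrite ?rnorm_ge0// lerDl.
  by rewrite mulrAC divfK// gt_eqF.
rewrite {1}[v](projC fE (fun n => n < N2)%N) addrAC subrr add0r.
rewrite (eq_proj fE _ (T := fun n => N2 <= n)%N); last by move=> n /=; rewrite -leqNgt.
apply: (@le_trans _ _ ((M' * C * rnorm x) * (eps / 2 / (M' * C)))).
  apply: ler_pM; rewrite ?rnorm_ge0//; last exact: ltW.
  by have [_] := fP1; apply.
by rewrite mulrC mulrA divfK// gt_eqF// mulr_gt0.
Qed.

(** The norms are dominated by a geometric series, so the pointwise limit is a limit in operator
    norm and the Roe algebra is closed under it. *)
Lemma roe_series (u : nat -> E -> E) B : (forall n, roe (u n)) ->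
  (forall n x, rnorm (u n x) <= B * 2 ^- n.+1 * rnorm x) ->
  exists2 T, roe T & forall x, (fun N => \sum_(n < N) u n x) @ \oo --> T x.
Proof.
move=> ru uB.
have B0 : 0 <= B.
  have := uB 0%N (e 0%N); rewrite (frame_norm fE) mulr1 => /(le_trans (rnorm_ge0 _)).
  by rewrite pmulr_lge0// half_pow_gt0.
have tailB x m n : (m <= n)%N ->
    rnorm (\sum_(i < n) u i x - \sum_(i < m) u i x) <= B * 2 ^- m * rnorm x.
  move=> mn; rewrite -!(big_mkord xpredT (fun i => u i x)) (big_cat_nat _ mn)//= addrAC subrr add0r.
  rewrite (le_trans (rnorm_sum _ _ _))//.
  apply: (@le_trans _ _ (\sum_(m <= i < n) B * 2 ^- i.+1 * rnorm x)); first exact: ler_sum.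
  by rewrite -mulr_suml -mulr_sumr ler_wpM2r ?rnorm_ge0// ler_wpM2l// half_pow_sum.
have cv x : exists l : E, (fun N => \sum_(n < N) u n x) @ \oo --> l.
  apply: cauchy_rnorm_cvg => eps e0.
  have [N BN] := half_pow_cvg0 (B * rnorm x) e0.
  exists N => m n Nm mn; rewrite (le_lt_trans (tailB x m n mn))// (le_lt_trans _ BN)//.
  rewrite mulrAC ler_wpM2l ?mulr_ge0 ?rnorm_ge0//; exact: half_pow_le.
pose T x := projT1 (cid (cv x)).
have Tcv x : (fun N => \sum_(n < N) u n x) @ \oo --> T x by exact: projT2 (cid (cv x)).
have TB x m : rnorm (T x - \sum_(i < m) u i x) <= B * 2 ^- m * rnorm x.
  have H : (fun N => \sum_(n < N) u n x - \sum_(i < m) u i x) @ \oo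
      --> T x - \sum_(i < m) u i x by apply: cvgB (Tcv x) _; exact: cvg_cst.
  apply: cvg_norm_le H _ => n; exists (maxn m n); first exact: leq_maxr.
  by apply: tailB; exact: leq_maxl.
have blu n : bl (u n) := roe_bl (ru n).
have linT : linear T.
  move=> k x y; apply: cvg_rnorm_unique (Tcv _) _.
  rewrite (_ : (fun N => _) = fun N => k *: (\sum_(n < N) u n x) + \sum_(n < N) u n y).
    by apply: cvgD; [apply: cvgZr|].
  apply/funext => N; rewrite scaler_sumr -big_split.
  by apply: eq_bigr => i _; rewrite /= (blD (blu _)) (blZ (blu _)).
have blT : bl T.
  exists B; split=> // x; have := TB x 0%N.
  by rewrite big_ord0 subr0 expr0 invr1 mulr1.
exists T => //; apply: roe_approx => // eps e0.
have [N BN] := half_pow_cvg0 B e0.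
exists (\sum_(n < N) u n); first exact: roe_sum.
move=> x; rewrite (_ : (\sum_(n < N) u n) x = \sum_(n < N) u n x).
  by rewrite (le_trans (TB x N))// ler_wpM2r ?rnorm_ge0// ltW.
by elim/big_rec2: _ => // i y1 y2 _ <-.
Qed.

Lemma ulf_ball_bounded r x : uniformly_locally_finite d ->
  exists N, forall y, d x y <= r -> (y < N)%N.
Proof.
move=> ulf; have r0 : 0 < Num.max r 1 by rewrite lt_max ltr01 orbT.
have [n /(_ x) xn] := ulf _ r0.
have /finite_seqP[s sE] : finite_set [set y | d x y <= Num.max r 1].
  by apply/finite_set_leP; exists n.
exists (\max_(i <- s) i).+1 => y xy; rewrite ltnS.
have /= ys : [set` s] y by rewrite -sE /= le_max xy.
by rewrite (big_rem y ys)/= leq_maxl.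
Qed.

Lemma ulf_bounded r N : uniformly_locally_finite d ->
  exists M, forall x y, (x < N)%N -> d x y <= r -> (y < M)%N.
Proof.
move=> ulf; elim: N => [|N [M NM]]; first by exists 0%N.
have [M' H] := ulf_ball_bounded r N ulf.
exists (maxn M M') => x y; rewrite ltnS leq_eqVlt leq_max => /orP[/eqP ->|xN] xy.
  by rewrite H// orbT.
by rewrite (NM _ _ xN).
Qed.

End RoeAlgebra.

(** * Entries of corners of Roe algebras *)

Section Sequences.

Lemma uniform_threshold (P : nat -> nat -> Prop) N :
  (forall i, exists s, forall t, (s <= t)%N -> P i t) ->
  exists s, forall t, (s <= t)%N -> forall i, (i < N)%N -> P i t.
Proof.
move=> H; elim: N => [|N [s sN]]; first by exists 0%N.
have [s' s'N] := H N; exists (maxn s s') => t; rewrite geq_max => /andP[st s't] i.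
by rewrite ltnS leq_eqVlt => /orP[/eqP ->|iN]; [exact: s'N|exact: sN].
Qed.

(** The recursion of a gliding hump: [z i] is chosen relative to the threshold [N i], and the next
    threshold lies beyond everything that [z i] involves, as measured by [bnd]. *)
Lemma dependent_sequence (T : Type) (P : nat -> T -> Prop) (bnd : T -> nat) :
  (forall N, exists z, P N z) ->
  exists (N : nat -> nat) (z : nat -> T), forall i,
    [/\ P (N i) (z i), (N i < N i.+1)%N & (bnd (z i) <= N i.+1)%N].
Proof.
move=> /choice[g Pg].
pose N i := iter i (fun n => maxn n.+1 (bnd (g n))) 0%N.
exists N, (g \o N) => i; split; first exact: Pg.
  by rewrite /= leq_maxl.
by rewrite /= leq_maxr.
Qed.

Lemma increasing_leq (N : nat -> nat) : (forall i, N i < N i.+1)%N ->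
  forall i j, (i < j)%N -> (N i.+1 <= N j)%N.
Proof.
move=> NS i; elim=> // j IH; rewrite ltnS leq_eqVlt => /orP[/eqP ->//|/IH h].
exact: leq_trans h (ltnW (NS j)).
Qed.

Lemma increasing_geq_id (N : nat -> nat) : (forall i, N i < N i.+1)%N ->
  forall i, (i <= N i)%N.
Proof. by move=> NS; elim=> // i IH; exact: leq_ltn_trans IH (NS i). Qed.

Lemma increasing_inj (u : nat -> nat) :
  (forall i j, (i < j)%N -> (u i < u j)%N) -> injective u.
Proof.
by move=> ult i j uij; have [/ult|/ult|//] := ltngtP i j; rewrite uij ltnn.
Qed.

Lemma exists_nat_gt (R : realType) (r : R) : exists n : nat, r < n%:R.
Proof.
exists (Num.bound `|r|); apply: le_lt_trans (ler_norm r) _.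
exact: archi_boundP.
Qed.

(** Each nonzero term at [j] is charged to some [i] with [y i = j]; as [i <= y i], only indices
    [i < N] occur, and the charges form a geometric series. *)
Lemma sum_sparse (R : realType) (g : nat -> R) (y : nat -> nat) B N :
  0 <= B -> (forall i, (i <= y i)%N) ->
  (forall j, (forall i, j <> y i) -> g j = 0) ->
  (forall i, g (y i) <= B * 2 ^- i.+1) -> \sum_(j < N) g j <= B.
Proof.
move=> B0 iy g0 gB.
have BS i : 0 <= B * 2 ^- i.+1 by rewrite mulr_ge0// ltW// half_pow_gt0.
apply: (@le_trans _ _ (\sum_(j < N) \sum_(i < N | y i == j) B * 2 ^- i.+1)).
  apply: ler_sum => j _; have [[i yij]|H] := pselect (exists i, nat_of_ord j = y i).
    have iN : (i < N)%N by rewrite (leq_ltn_trans (iy i))// -yij.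
    rewrite (bigD1 (Ordinal iN)) /= ?yij// (le_trans (gB i))// lerDl.
    by apply: sumr_ge0.
  rewrite g0; first by apply: sumr_ge0.
  by move=> i ji; apply: H; exists i.
rewrite (exchange_big_dep xpredT)//=.
apply: (@le_trans _ _ (\sum_(0 <= i < N) B * 2 ^- i.+1)).
  rewrite big_mkord; apply: ler_sum => i _.
  have [yN|Ny] := ltnP (y i) N.
    by rewrite (big_pred1 (Ordinal yN))// => j /=; rewrite eq_sym -val_eqE.
  rewrite big_pred0// => j; apply/negbTE; rewrite neq_ltn orbC.
  by rewrite (leq_trans (ltn_ord j)).
by rewrite -mulr_sumr ler_piMr// (le_trans (half_pow_sum _ _))// expr0 invr1.
Qed.

End Sequences.

(** The form in which symmetry of a basis is used: a partial translation between two sequences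
    extends by zero to a bounded operator. *)
Definition translations (R : realType) (E : completeNormedModType R[i])
    (d : nat -> nat -> R) (e : nat -> E) : Prop :=
  forall (r : R) (x y : nat -> nat), injective x -> injective y ->
    (forall i, d (x i) (y i) <= r) ->
    exists T : E -> E, [/\ bl T, forall i, T (e (y i)) = e (x i)
      & forall n, (forall i, n <> y i) -> T (e n) = 0].

Section Corner.
Context {R : realType} {E F : completeNormedModType R[i]}.
Context {d del : nat -> nat -> R} {e : nat -> E} {c : nat -> E -> R[i]}.
Context {f : nat -> F} {b : nat -> F -> R[i]} {C : R}.
Context (dm : is_metric d) (delm : is_metric del).
Context (d_ulf : uniformly_locally_finite d) (del_ulf : uniformly_locally_finite del).
Context (fE : frame e c C) (fF : frame f b C) (trE : translations d e).
Context {U : E -> F} {V : F -> E} (UC : bounded_by C U) (VC : bounded_by C V).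
Context (UV : forall a, roe d e c a -> roe del f b (U \o a \o V)).

Let C1 : 1 <= C. Proof. exact: frame_const_ge1 fE. Qed.
Let C0 : 0 < C. Proof. by have := C1; lra. Qed.
Let blU : bl U. Proof. exact: bounded_by_bl UC. Qed.
Let blV : bl V. Proof. exact: bounded_by_bl VC. Qed.

Let roe_coord z x : roe d e c (rank1 z (c x)).
Proof.
apply: (roe_rank1 dm fE z (functional_coord fE x)).
exact: (shrinking_coord fE).
Qed.

(** The rank one operator [U z (x) (c x \o V)] lies in the Roe algebra. The [k]-th row of a band
    operator has finite support, since balls are finite, so the [k]-th row of this operator has
    small tails. That row is [c x \o V] times [b k (U z)], and some [k] makes this factor
    nonzero. *)
Lemma shrinking_corner x : (exists z, U z != 0) -> shrinking b (c x \o V).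
Proof.
move=> [z Uz0].
have [k bk0] : exists k, b k (U z) != 0.
  apply: contrapT => H; move/eqP: Uz0; apply; apply: (coord_inj fF) => k.
  rewrite (coord0 fF); apply: contrapT => /eqP bk; apply: H; by exists k.
have nb0 : 0 < rnorm (b k (U z)) by rewrite rnorm_gt0.
move=> eps e0.
have e1 : 0 < eps * rnorm (b k (U z)) / (C * C) by rewrite divr_gt0 ?mulr_gt0.
have [_ /(_ _ e1)[r [T [[blT rT] HT]]]] := UV (roe_coord z x).
have [N0 HN0] := ulf_ball_bounded r k del_ulf.
exists N0 => N NN y; set w := proj b _ y.
have Tw : b k (T w) = 0.
  have fT : functional C (b k) := functional_coord fF k.
  have [M M1 TM] := bl_bound blT.
  apply: (functional_vanish fF (phi := b k \o T) (M := C * M)).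
    by apply: functional_comp fT TM; exact: ltW.
  move=> i /=; have [iN|Ni] := ltnP i N.
    by left; rewrite (projE fF) leqNgt iN.
  right; apply: rT; rewrite ltNge (metric_symmetric delm); apply/negP => /HN0.
  by rewrite ltnNge (leq_trans NN Ni).
have := HT w; rewrite /= /rank1 (blZ blU) => /(ler_wpM2l (ltW C0)).
move=> /(le_trans (coord_le fF k _)); rewrite (coordB fF) Tw subr0 (coordZ fF) rnormM.
rewrite -ler_pdivlMr// => /le_trans; apply; rewrite ler_pdivrMr//.
apply: (@le_trans _ _ (C * (eps * rnorm (b k (U z)) / (C * C) * (C * rnorm y)))).
  by rewrite ler_pM2l// ler_pM2l//; exact: (proj_le fF).
rewrite le_eqVlt; apply/orP; left; apply/eqP; field; rewrite gt_eqF//.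
Qed.

Definition entry k m x y : R := rnorm (b k (U (e x)) * c y (V (f m))).

(** For a single matrix unit this is membership of its image in the Roe algebra. The threshold
    depends on [x] and [y]; [entries_controlled] removes this dependence. *)
Lemma entry_far x y (eps : R) : 0 < eps -> exists s : nat, forall t, (s <= t)%N ->
  forall k m, t%:R < del k m -> entry k m x y <= eps.
Proof.
move=> e0; have [_ /(_ _ (divr_gt0 e0 C0))[r [T [[blT rT] HT]]]] := UV (roe_coord (e x) y).
have [s rs] := exists_nat_gt r; exists s => t st k m tkm.
have Tk : b k (T (f m)) = 0.
  apply: rT; rewrite (metric_symmetric delm); apply: lt_trans tkm.
  by apply: (lt_le_trans rs); rewrite ler_nat.
have := HT (f m); rewrite /= /rank1 (blZ blU) (frame_norm fF) mulr1.
rewrite ler_pdivlMr// mulrC; apply: le_trans.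
have := coord_le fF k (c y (V (f m)) *: U (e x) - T (f m)).
by rewrite (coordB fF) Tk subr0 (coordZ fF) [c y _ * _]mulrC.
Qed.

Lemma band_translation (x y : nat -> nat) r T : injective x -> injective y ->
  (forall i, d (x i) (y i) <= r) -> bl T -> (forall i, T (e (y i)) = e (x i)) ->
  (forall n, (forall i, n <> y i) -> T (e n) = 0) -> band d e c r T.
Proof.
move=> xinj yinj xyr blT Ty T0; split=> // n m nm.
have [[i ni]|H] := pselect (exists i, n = y i); last first.
  by rewrite T0 ?(coord0 fE)// => i ni; apply: H; exists i.
rewrite ni Ty (frame_delta fE); have [mi|//] := eqVneq m (x i).
by move: nm; rewrite ni mi (metric_symmetric dm) ltNge xyr.
Qed.

(* Far-away matrix entries of [U e_(x,y) V] are small, uniformly over the matrix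
   units [e_(x,y)] of bounded propagation: otherwise a gliding hump produces a
   partial translation [T] whose image [U T V] has large entries arbitrarily far
   from the diagonal. *)
Lemma entries_controlled (r delta : R) : 0 < delta -> exists s : nat,
  forall x y k m, d x y <= r -> delta <= entry k m x y -> del k m <= s%:R.
Proof.
move=> delta0; apply: contrapT => Hno.
have far (s : nat) : exists x y k m,
    [/\ d x y <= r, delta <= entry k m x y & s%:R < del k m].
  apply: contrapT => Hs; apply: Hno; exists s => x y k m xy ent.
  by rewrite leNgt; apply/negP => skm; apply: Hs; exists x, y, k, m.
(* Tolerances whose sum is at most [delta / 4], as [sum_sparse] requires. *)
pose small n := delta / 4 * 2 ^- n.+1.
have small0 n : 0 < small n by rewrite mulr_gt0 ?half_pow_gt0//; lra.
have smalld n : small n < delta.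
  have : 2 ^- n.+1 <= 1 :> R by rewrite invf_le1 ?exprn_gt0// exprn_ege1// ler1n.
  by rewrite /small => h; apply: (@le_lt_trans _ _ (delta / 4)); [apply: ler_piMr|]; lra.
have smallW i n : (i <= n)%N -> small n <= small i.
  by move=> i_n; rewrite /small ler_pM2l ?half_pow_le//; lra.
(* The last two clauses bound the interference between humps: matrix units with indices below [N]
   contribute little at the new position [(k, m)], and the new matrix unit contributes little in the
   columns below [N]. *)
pose good N (q : nat * nat * nat * nat) := let: (x, y, k, m) := q in
  [/\ d x y <= r, delta <= entry k m x y, N%:R < del k m, (N <= x)%N && (N <= y)%N &
   (forall x' y', (x' < N)%N -> (y' < N)%N -> entry k m x' y' <= small y') /\
   (forall k' m', (m' < N)%N -> entry k' m' x y <= small N)].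
have step N : exists q, good N q.
  (* The finitely many vectors [V (f m')] have small coordinates beyond [M0]; taking [y] there gives
     the last clause of [good]. *)
  have [M0 HM0] : exists s, forall t, (s <= t)%N -> forall m', (m' < N)%N ->
      rnorm (c t (V (f m'))) < small N / (C * C).
    apply: (uniform_threshold (P := fun m' t => rnorm (c t (V (f m'))) < small N / (C * C))) => m'.
    by apply: (coord_cvg0 fE); rewrite divr_gt0// mulr_gt0.
  pose N1 := maxn N M0.
  have [M1 HM1] := ulf_bounded r N1 d_ulf.
  pose M := maxn N1 M1.
  have [s Hs] : exists s, forall t, (s <= t)%N -> forall x', (x' < M)%N ->
      forall y', (y' < M)%N -> forall k m, t%:R < del k m -> entry k m x' y' <= small y'.
    apply: (uniform_threshold (P := fun x' t => forall y', (y' < M)%N ->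
      forall k m, t%:R < del k m -> entry k m x' y' <= small y')) => x'.
    apply: (uniform_threshold (P := fun y' t =>
      forall k m, t%:R < del k m -> entry k m x' y' <= small y')) => y'.
    exact: entry_far.
  have [x [y [k [m [xy ent skm]]]]] := far (maxn s N).
  (* If [x] or [y] were below [N1], both would be below [M] by finiteness of balls. Only finitely
     many matrix units are of this kind, and [s] was chosen so that none has a large entry this far
     out. *)
  have N1xy : (N1 <= x)%N && (N1 <= y)%N.
    rewrite (leqNgt N1 x) (leqNgt N1 y) -negb_or; apply/negP => xyN1.
    have xyM : (x < M)%N && (y < M)%N.
      case/orP: xyN1 => [xN1|yN1]; apply/andP; split; rewrite /M leq_max.
      - by rewrite xN1.
      - by rewrite (HM1 _ _ xN1 xy) orbT.
      - by rewrite (HM1 _ _ yN1) ?orbT// (metric_symmetric dm).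
      - by rewrite yN1.
    case/andP: xyM => xM yM.
    have := Hs _ (leq_maxl s N) _ xM _ yM _ _ skm.
    by move=> /(le_trans ent); rewrite leNgt smalld.
  have NN1 : (N <= N1)%N by rewrite leq_maxl.
  case/andP: N1xy => N1x N1y.
  exists (x, y, k, m); split=> //.
  - by apply: le_lt_trans skm; rewrite ler_nat leq_maxr.
  - by rewrite !(leq_trans NN1).
  - split=> [x' y' x'N y'N|k' m' m'N].
      apply: (Hs _ (leq_maxl s N)) skm.
        by rewrite (leq_trans x'N)// (leq_trans NN1)// leq_maxl.
      by rewrite (leq_trans y'N)// (leq_trans NN1)// leq_maxl.
    rewrite /entry rnormM.
    have H1 : rnorm (b k' (U (e x))) <= C * C.
      rewrite (le_trans (coord_le fF _ _))// ler_pM2l//.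
      by have [_ /(_ (e x))] := UC; rewrite (frame_norm fE) mulr1.
    have H2 := HM0 _ (leq_trans (leq_maxr N M0) N1y) _ m'N.
    rewrite (le_trans (ler_pM (rnorm_ge0 _) (rnorm_ge0 _) H1 (ltW H2)))//.
    by rewrite mulrC divfK// gt_eqF// mulr_gt0.
pose bnd (q : nat * nat * nat * nat) := let: (x, y, k, m) := q in
  (maxn (maxn x y) m).+1.
have [N [q Hq]] := dependent_sequence bnd step.
have NS i : (N i < N i.+1)%N by case: (Hq i).
pose x i := (q i).1.1.1; pose y i := (q i).1.1.2.
pose k i := (q i).1.2; pose m i := (q i).2.
have Hgood i : good (N i) (x i, y i, k i, m i).
  by case: (Hq i) => + _ _; rewrite /x /y /k /m; case: (q i) => -[[? ?] ?] ?.
have Hbnd i : [/\ (x i < N i.+1)%N, (y i < N i.+1)%N & (m i < N i.+1)%N].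
  case: (Hq i) => _ _; rewrite /x /y /k /m; case: (q i) => -[[x0 y0] k0] m0 /= h.
  by split; apply: leq_trans h; rewrite ltnS; lia.
have xyr i : d (x i) (y i) <= r by case: (Hgood i).
have Nx i : (N i <= x i)%N by case: (Hgood i) => _ _ _ /andP[].
have Ny i : (N i <= y i)%N by case: (Hgood i) => _ _ _ /andP[].
have iN := increasing_geq_id NS; have NSS := increasing_leq NS.
have xlt i j : (i < j)%N -> (x i < x j)%N.
  move=> ij; have [h _ _] := Hbnd i.
  by rewrite (leq_trans h)// (leq_trans (NSS _ _ ij)).
have ylt i j : (i < j)%N -> (y i < y j)%N.
  move=> ij; have [_ h _] := Hbnd i.
  by rewrite (leq_trans h)// (leq_trans (NSS _ _ ij)).
have xinj := increasing_inj xlt; have yinj := increasing_inj ylt.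
have [T [blT Ty T0]] := trE xinj yinj xyr.
have /band_roe/UV[blUTV] := band_translation xinj yinj xyr blT Ty T0.
have d4 : 0 < delta / 4 / C by rewrite !divr_gt0.
move=> /(_ _ d4)[r' [S [[blS rS] HS]]].
have [n r'n] := exists_nat_gt r'.
have nkm : r' < del (m n) (k n).
  case: (Hgood n) => _ _ Nkm _ _; rewrite (metric_symmetric delm).
  by apply: lt_trans Nkm; apply: (lt_le_trans r'n); rewrite ler_nat.
(* [phi z] is the entry of [U T V] at [(k n, m n)], which lies outside the band of [S]. It is
   therefore at most [delta / 4], while the [n]-th hump alone contributes at least [delta]. *)
pose phi := b (k n) \o (U \o T).
have [M M1 [_ UTM]] := bl_bound (bl_comp blU blT).
have fphi : functional (C * M) phi.
  apply: functional_comp; [exact: ltW|exact: (functional_coord fF)|].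
  by split=> //; case: (bl_comp blU blT) => ? [].
have blphi : bl (phi : E -> (R[i])^o) by exact: bounded_by_bl fphi.
set z := V (f (m n)).
have small_phi : rnorm (phi z) <= delta / 4.
  have := HS (f (m n)); rewrite (frame_norm fF) mulr1 ler_pdivlMr// mulrC.
  apply: le_trans; apply: (le_trans _ (coord_le fF (k n) _)).
  by rewrite (coordB fF) rS// subr0.
pose z' := z - c (y n) z *: e (y n).
have phiy i : phi (e (y i)) = b (k n) (U (e (x i))) by rewrite /phi /= Ty.
have rest : rnorm (phi z') <= delta / 4.
  apply: (functional_coord_bound fE fphi) => K.
  apply: (@sum_sparse _ (fun j => rnorm (c j z') * rnorm (phi (e j))) y).
  - lra.
  - by move=> i; exact: leq_trans (iN i) (Ny i).
  - move=> j jy; rewrite /phi /= T0// (bl0 blU) (coord0 fF).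
    by rewrite rnorm0 mulr0.
  - move=> i; rewrite -/(small i) /z' (coordB fE) (coordZ fE) (frame_delta fE).
    have [->|yin] := eqVneq (y i) (y n).
      by rewrite mulr1 subrr rnorm0 mul0r ltW.
    rewrite mulr0 subr0 phiy mulrC -rnormM -/(entry (k n) (m n) (x i) (y i)).
    (* Earlier humps are controlled by the choice of hump [n], later ones by their own choice
       relative to the column [m n]. *)
    have [i_n|n_i|i_n] := ltngtP i n; last by move: yin; rewrite i_n eqxx.
      case: (Hgood n) => _ _ _ _ [/(_ (x i) (y i)) h _].
      have [xiN yiN _] := Hbnd i.
      apply: (le_trans (h _ _)).
      + exact: leq_trans xiN (NSS _ _ i_n).
      + exact: leq_trans yiN (NSS _ _ i_n).
      + by apply: smallW; exact: leq_trans (iN i) (Ny i).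
    case: (Hgood i) => _ _ _ _ [_ /(_ (k n) (m n)) h].
    have [_ _ mnN] := Hbnd n.
    apply: (le_trans (h _)); first exact: leq_trans mnN (NSS _ _ n_i).
    exact: smallW.
have : delta <= rnorm (phi z - phi z').
  rewrite -(blB blphi) /z' opprB addrCA subrr addr0 (blZ blphi) phiy.
  rewrite (_ : rnorm _ = entry (k n) (m n) (x n) (y n)); first by case: (Hgood n).
  by rewrite /entry mulrC.
have := rnormB (phi z) (phi z'); lra.
Qed.

End Corner.

(** * Ghost idempotents *)

Section Thresholds.
Context {R : realType}.

(** Indices of maximal weight are removed as long as [Q] persists; the last level at which it holds
    is [w k]. *)
Lemma weight_threshold (w : nat -> R) (Q : pred nat -> Prop) (N : nat) (S : pred nat) :
  (forall n, S n -> (n < N)%N) -> Q S -> ~ Q xpred0 ->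
  exists k, [/\ S k, Q (fun j => S j && (w j <= w k)) &
    ~ Q (fun j => S j && (w j < w k))].
Proof.
move=> + + Q0; have [n] := ubnP #|[pred i : 'I_N | S i]|.
elim: n S => // n IH S; rewrite ltnS => Sn SN QS.
have [[i0 Si0]|S0] := pselect (exists i, S i); last first.
  case: Q0; rewrite (_ : xpred0 = S)//; apply/funext => i.
  by apply/esym/negbTE/negP => Si; apply: S0; exists i.
pose k : 'I_N := [arg max_(i > Ordinal (SN _ Si0) | S i) w i]%O.
have [Sk kmax] : S k /\ forall j : 'I_N, S j -> w j <= w k.
  by rewrite /k; case: arg_maxP => // j Sj jmax; split.
have Sle : (fun j => S j && (w j <= w k)) = S.
  apply/funext => j; case: (boolP (S j)) => //= Sj.
  exact: (kmax (Ordinal (SN _ Sj))).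
have [Qlt|nQlt] := pselect (Q (fun j => S j && (w j < w k))); last first.
  by exists k; rewrite Sle.
pose S' j := S j && (w j < w k).
have [||k' [/andP[Sk' wk'] Qk' nQk']] := IH S' _ _ Qlt.
- apply: leq_trans Sn; apply: proper_card; apply/properP; split.
    by apply/fintype.subsetP => j; rewrite !inE => /andP[].
  by exists k; rewrite !inE // /S' ltxx andbF.
- by move=> j /andP[/SN].
have E (P : pred nat) : (forall j, P j -> w j < w k) ->
    (fun j => S' j && P j) = (fun j => S j && P j).
  move=> H; apply/funext => j; rewrite /S' -andbA; congr (_ && _).
  by case: (boolP (P j)) => [/H ->//|_]; rewrite andbF.
exists k'; split=> //.
  by rewrite -(E (fun j => w j <= w k'))// => j /le_lt_trans; apply.
by rewrite -(E (fun j => w j < w k'))// => j /lt_trans; apply.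
Qed.

End Thresholds.

Section SparseExpansion.
Context {R : realType} {E : completeNormedModType R[i]} {e : nat -> E}.
Context {c : nat -> E -> R[i]} {C : R} (fE : frame e c C).

(** As [x] increases, what the [M]-th partial sum misses is a projection of the tail of [z] from
    [x M] on. *)
Lemma sparse_expansion (x : nat -> nat) z : (forall i j, (i < j)%N -> (x i < x j)%N) ->
  (fun M => \sum_(n < M) c (x n) z *: e (x n)) @ \oo
    --> proj c (fun j => `[< exists i, j = x i >]) z.
Proof.
move=> xlt; set A : pred nat := fun j => `[< _ >].
have xinj := increasing_inj xlt.
have ix i : (i <= x i)%N by elim: i => // i IH; exact: leq_ltn_trans IH (xlt i i.+1 (ltnSn i)).
have xle i j : (x i <= x j)%N = (i <= j)%N.
  have [ij|/xlt ji] := leqP i j; last by rewrite leqNgt ji.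
  by move: ij; rewrite leq_eqVlt => /orP[/eqP ->|/xlt/ltnW//]; rewrite leqnn.
have diffE M : proj c A z - \sum_(n < M) c (x n) z *: e (x n) =
    proj c A (proj c (fun j => x M <= j)%N z).
  apply: (coord_inj fE) => j; rewrite (coordB fE) (coord_sum fE) !(projE fE).
  under eq_bigr do rewrite (coordZ fE) (frame_delta fE).
  case: ifPn => [/asboolP[i ->]|Aj].
    rewrite xle; have [Mi|iM] := leqP M i.
      rewrite big1 ?subr0// => n _; rewrite (inj_eq xinj).
      by rewrite gtn_eqF ?mulr0// (leq_trans (ltn_ord n)).
    rewrite (bigD1 (Ordinal iM))//= eqxx mulr1 big1 ?addr0 ?subrr// => n ni.
    rewrite (inj_eq xinj) (_ : i == n = false) ?mulr0//.
    by apply: contraNF ni => /eqP ni; apply/eqP/val_inj.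
  rewrite big1 ?subr0// => n _; rewrite (_ : j == x n = false) ?mulr0//.
  by apply: contraNF Aj => /eqP ->; apply/asboolP; exists n.
apply/cvg_rnormP => eps e0.
have C0 : 0 < C by have := frame_const_ge1 fE; lra.
have [N0 H] := proj_tail_cvg0 fE z (divr_gt0 e0 C0).
exists N0 => M N0M; rewrite diffE (le_lt_trans (proj_le fE _ _))// mulrC.
by rewrite -ltr_pdivlMr// H// (leq_trans N0M).
Qed.

End SparseExpansion.

Section GhostBlocks.
Context {R : realType} {E F : completeNormedModType R[i]}.
Context {d del : nat -> nat -> R} {e : nat -> E} {c : nat -> E -> R[i]}.
Context {f : nat -> F} {b : nat -> F -> R[i]} {C : R}.
Context (dm : is_metric d) (delm : is_metric del).
Context (fE : frame e c C) (fF : frame f b C).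
Context {U : E -> F} {V : F -> E} (UC : bounded_by C U) (VC : bounded_by C V).
Context (UV : forall a, roe d e c a -> roe del f b (U \o a \o V)).
Context (VU : forall x, V (U x) = x).
Context (shV : forall x, shrinking b (c x \o V)).
Context (shU : forall k, shrinking c (b k \o U)).
(** [w k] stands for the norm of the [k]-th basis vector of [F] before normalisation. *)
Context (w : nat -> R) (w_gt0 : forall k, 0 < w k).
Context (w_coarse : forall r, exists2 Om, 1 <= Om &
  forall k m, del k m <= r -> w k <= Om * w m).

Let C1 : 1 <= C. Proof. exact: frame_const_ge1 fE. Qed.
Let C0 : 0 < C. Proof. by have := C1; lra. Qed.
Let blU : bl U. Proof. exact: bounded_by_bl UC. Qed.
Let blV : bl V. Proof. exact: bounded_by_bl VC. Qed.

Let phi x (y : F) : R[i] := c x (V y).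
Let u x : F := U (e x).

Let fphi x : functional (C * C) (phi x).
Proof. by apply: functional_comp VC; [exact: ltW|exact: (functional_coord fE)]. Qed.

Let phi_le x y : rnorm (phi x y) <= C * C * rnorm y.
Proof. by have [_] := fphi x; apply. Qed.

Let phiD x y z : phi x (y + z) = phi x y + phi x z.
Proof. by rewrite /phi (blD blV) (coordD fE). Qed.

Let u_le x : rnorm (u x) <= C.
Proof. by have [_ /(_ (e x))] := UC; rewrite (frame_norm fE) mulr1. Qed.

Let phiu x : phi x (u x) = 1.
Proof. by rewrite /phi /u VU (frame_delta fE) eqxx. Qed.

Definition block N N' : pred nat := fun k => (N <= k < N')%N.

(** The vector [u x] and the functional [phi x] live on the block up to [eps]. The square in the
    last clause forces, at each [k], one of the two factors to be at most [eps]. *)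
Definition good_block (eps : R) N N' x : Prop :=
  [/\ rnorm (proj b (fun k => k < N)%N (u x)) <= eps,
      rnorm (proj b (fun k => N' <= k)%N (u x)) <= eps,
      (forall y, rnorm (phi x (proj b (fun k => k < N)%N y)) <= eps * rnorm y),
      (forall y, rnorm (phi x (proj b (fun k => N' <= k)%N y)) <= eps * rnorm y) &
      forall k, rnorm (b k (u x) * phi x (f k)) <= eps ^+ 2].

(** For a fixed [k], [b k (u x)] tends to 0 in [x] because [b k \o U] is shrinking, and
    [phi x (f k)] does because it is a coordinate of the fixed vector [V (f k)]. *)
Lemma head_small N (eps : R) : 0 < eps -> exists X, forall x, (X <= x)%N ->
  rnorm (proj b (fun k => k < N)%N (u x)) <= eps /\
  forall y, rnorm (phi x (proj b (fun k => k < N)%N y)) <= eps * rnorm y.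
Proof.
move=> e0.
have N1 : 0 < N.+1%:R * C :> R by rewrite mulr_gt0.
(* Divides [eps] among the [N] coordinates and absorbs the norm [C] of a coordinate functional;
   [N.+1] avoids division by zero. *)
pose e' := eps / (N.+1%:R * C).
have e'0 : 0 < e' by rewrite divr_gt0.
have e'E : N.+1%:R * e' * C = eps by rewrite mulrAC mulrC divfK// gt_eqF.
have [X HX] : exists X, forall x, (X <= x)%N -> forall k, (k < N)%N ->
    rnorm (b k (u x)) <= e' /\ rnorm (phi x (f k)) <= e'.
  apply: (uniform_threshold (P := fun k x =>
    rnorm (b k (u x)) <= e' /\ rnorm (phi x (f k)) <= e')) => k.
  have [X1 H1] := shrinking_basis_cvg0 fE (shU k) e'0.
  have [X2 H2] := coord_cvg0 fE (V (f k)) e'0.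
  exists (maxn X1 X2) => x; rewrite geq_max => /andP[/H1 h1 /H2 h2].
  by split=> //; exact: ltW.
have sumN (g : nat -> R) B : 0 <= B -> (forall k, (k < N)%N -> g k <= B) ->
    \sum_(k < N | (k < N)%N) g k <= N.+1%:R * B.
  move=> B0 gB; apply: (@le_trans _ _ (\sum_(k < N) B)).
    under eq_bigl do rewrite ltn_ord.
    by apply: ler_sum => k _; apply: gB.
  by rewrite sumr_const card_ord -[B *+ N]mulr_natl; apply: ler_wpM2r => //; rewrite ler_nat.
exists X => x /HX{}HX; split.
  rewrite (le_trans (@proj_fin_le _ _ _ _ _ fF _ N _ _))//.
  rewrite (le_trans (sumN (fun k => rnorm (b k (u x))) e' (ltW e'0) _))//.
    by move=> k /HX[].
  by rewrite -e'E ler_peMr// mulr_ge0// ltW.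
move=> y; rewrite (@proj_finE _ _ _ _ _ fF _ N)//.
have blp : bl (phi x : F -> (R[i])^o) by exact: bounded_by_bl (fphi x).
rewrite (_ : phi x _ = \sum_(k < N | (k < N)%N) b k y * phi x (f k)); last first.
  by rewrite (bl_sum blp); apply: eq_bigr => k _; rewrite (blZ blp).
rewrite (le_trans (rnorm_sum _ _ _))//.
rewrite (le_trans (sumN (fun k => rnorm (b k y * phi x (f k))) (C * rnorm y * e') _ _))//.
- by apply: mulr_ge0; [apply: mulr_ge0; [exact: ltW|exact: rnorm_ge0]|exact: ltW].
- move=> k /HX[_ h]; rewrite rnormM ler_pM ?rnorm_ge0//; exact: (coord_le fF).
- by rewrite -e'E le_eqVlt; apply/orP; left; apply/eqP; ring.
Qed.

Hypothesis small_diag : forall delta : R, 0 < delta ->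
  exists x, forall k, rnorm (b k (u x) * phi x (f k)) < delta.

(** Since [phi x (u x) = 1], every [x] has a nonzero diagonal entry. A bound below the entries thus
    found for the finitely many small [x] forces an [x] with smaller diagonal to be large. Any later
    end of the block is also good, which lets the sequence of blocks be chosen contiguous. *)
Lemma block_step N (eps : R) : 0 < eps -> exists x N', (N <= x)%N /\
  forall M, (N' <= M)%N -> good_block eps N M x.
Proof.
move=> e0; have [X HX] := head_small N e0.
have [s Hs] : exists s, forall t, (s <= t)%N -> forall x, (x < maxn N X)%N ->
    exists k, 2 ^- t < rnorm (b k (u x) * phi x (f k)).
  apply: (uniform_threshold (P := fun x t =>
    exists k, 2 ^- t < rnorm (b k (u x) * phi x (f k)))) => x.
  have [k k0] : exists k, b k (u x) * phi x (f k) != 0.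
    apply: contrapT => H; suff h0 : phi x (u x) = 0.
      by have := oner_neq0 R[i]; rewrite -(phiu x) h0 eqxx.
    apply: (functional_vanish fF (fphi x)) => k.
    have /eqP : b k (u x) * phi x (f k) = 0 by apply: contrapT => /eqP h; apply: H; exists k.
    by rewrite mulf_eq0 => /orP[/eqP h|/eqP h]; [left|right].
  have n0 : 0 < rnorm (b k (u x) * phi x (f k)) by rewrite rnorm_gt0.
  have [s Hs] := half_pow_cvg0 1 n0.
  exists s => t /half_pow_le st; exists k; apply: le_lt_trans Hs.
  by rewrite mul1r.
have m0 : 0 < Num.min (eps ^+ 2) (2 ^- s) by rewrite lt_min exprn_gt0//= half_pow_gt0.
have [x Hx] := small_diag m0.
have xNX : (maxn N X <= x)%N.
  rewrite leqNgt; apply/negP => /(Hs _ (leqnn s))[k]; rewrite ltNge => /negP; apply.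
  by have := Hx k; rewrite lt_min => /andP[_ /ltW].
have [Nx Xx] : (N <= x)%N /\ (X <= x)%N by split; lia.
have [h1 h2] := HX _ Xx.
have [M1 H1] := proj_tail_cvg0 fF (u x) e0.
have [M2 H2] := shV x e0.
exists x, (maxn M1 M2); split=> // M; rewrite geq_max => /andP[/H1 h3 /H2 h4].
split=> //; first exact: ltW.
by move=> k; have := Hx k; rewrite lt_min => /andP[/ltW].
Qed.

Lemma block_rest N N' y : (N <= N')%N ->
  y - proj b (block N N') y = proj b (fun k => k < N)%N y + proj b (fun k => N' <= k)%N y.
Proof.
move=> NN'; apply: (coord_inj fF) => k.
rewrite (coordB fF) (coordD fF) !(projE fF) /block.
case: (ltnP k N) => kN; case: (leqP N' k) => kN' /=;
  rewrite ?subr0 ?addr0 ?add0r ?subrr//; lia.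
Qed.

(* Off the block, the rank one idempotent [U e_(x,x) V] is small in norm. *)
Lemma block_compression eps N N' x y : 0 < eps -> (N <= N')%N -> good_block eps N N' x ->
  rnorm (phi x y *: u x - phi x (proj b (block N N') y) *: proj b (block N N') (u x))
    <= 4 * C ^+ 3 * eps * rnorm y.
Proof.
move=> e0 NN' [h1 h2 h3 h4 _].
set P := proj b (block N N').
rewrite -(subrK (phi x (P y) *: u x) (phi x y *: u x)) -addrA -scalerBl -scalerBr.
rewrite (le_trans (rnormD _ _))// !rnormZ.
have -> : phi x y - phi x (P y) = phi x (y - P y) by rewrite /phi (blB blV) (coordB fE).
have a1 : rnorm (phi x (y - P y)) <= 2 * eps * rnorm y.
  rewrite block_rest// phiD (le_trans (rnormD _ _))//.
  by have := h3 y; have := h4 y; lra.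
have a2 : rnorm (u x - P (u x)) <= 2 * eps.
  by rewrite block_rest// (le_trans (rnormD _ _))//; lra.
have a3 : rnorm (phi x (P y)) <= C ^+ 3 * rnorm y.
  rewrite (le_trans (phi_le _ _))// !exprS expr0 mulr1 -!mulrA !ler_wpM2l ?(ltW C0)//.
  exact: (proj_le fF).
have y0 := rnorm_ge0 y.
have b1 := ler_pM (rnorm_ge0 _) (rnorm_ge0 _) a1 (u_le x).
have b2 := ler_pM (rnorm_ge0 _) (rnorm_ge0 _) a3 a2.
rewrite (le_trans (lerD b1 b2))//.
have : C <= C ^+ 3 by rewrite ler_eXnr.
have : 0 <= eps * rnorm y by rewrite mulr_ge0// ltW.
by move=> ey CC; have := ler_wpM2r ey CC; lra.
Qed.

(** Head and tail of [u x] each take at most [C ^+ 2 * eps <= 1 / 8] from [phi x (u x) = 1]. *)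
Lemma block_pairing eps N N' x : 0 < eps -> eps <= (8 * C ^+ 2)^-1 -> (N <= N')%N ->
  good_block eps N N' x -> 3 / 4 <= rnorm (phi x (proj b (block N N') (u x))).
Proof.
move=> e0 eC NN' [h1 h2 _ _ _].
have C20 : 0 < C ^+ 2 by rewrite exprn_gt0.
have H z : rnorm z <= eps -> rnorm (phi x z) <= 1 / 8.
  move=> ze; rewrite (le_trans (phi_le _ _))// -expr2.
  rewrite (le_trans (ler_wpM2l (ltW C20) (le_trans ze eC)))//.
  by rewrite invfM mulrCA divff ?gt_eqF// mulr1; lra.
have : phi x (u x) = phi x (proj b (block N N') (u x)) +
    (phi x (proj b (fun k => k < N)%N (u x)) + phi x (proj b (fun k => N' <= k)%N (u x))).
  by rewrite -!phiD -block_rest// addrCA subrr addr0.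
rewrite phiu => E1; have := rnorm1 (R := R); rewrite E1 => n1.
have := rnormD (phi x (proj b (block N N') (u x))) 
  (phi x (proj b (fun k => k < N)%N (u x)) + phi x (proj b (fun k => N' <= k)%N (u x))).
have := rnormD (phi x (proj b (fun k => k < N)%N (u x)))
  (phi x (proj b (fun k => N' <= k)%N (u x))).
have := H _ h1; have := H _ h2; lra.
Qed.

(* The weights [w] vary boundedly over bounded distances, so up to the error of
   approximating [T] by a band operator, [u x] and [phi x] must concentrate on a
   common set where [w] is essentially constant; there they are moreover cut down
   to indices where one of them is uniformly small. *)
Lemma block_window T r Om eps N N' x : bl T ->
  (exists2 S, band del f b r S & forall y,
     rnorm (T y - S y) <= ((8 * C ^+ 2)^-1) ^+ 2 / C ^+ 2 * rnorm y) ->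
  1 <= Om -> (forall k m, del k m <= r -> w k <= Om * w m) ->
  0 < eps -> eps <= (8 * C ^+ 2)^-1 -> (N <= N')%N -> good_block eps N N' x ->
  (forall y, T (proj b (block N N') y) =
     phi x (proj b (block N N') y) *: proj b (block N N') (u x)) ->
  exists S : pred nat,
    [/\ forall k, S k -> block N N' k,
        forall k m, S k -> S m -> w m <= Om * w k,
        forall k m, S k -> S m -> rnorm (b k (u x)) * rnorm (phi x (f m)) <= C ^+ 2 * eps &
        1 / 4 <= rnorm (phi x (proj b S (u x)))].
Proof.
move=> blT [S [blS rS] TS] Om1 Omw e0 eC NN' gb TB.
have pair := block_pairing e0 eC NN' gb.
case: gb => _ _ _ _ diag.
set B := block N N' in TB pair *.
set eta := (8 * C ^+ 2)^-1.
have C20 : 0 < C ^+ 2 by rewrite exprn_gt0.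
have eta0 : 0 < eta by rewrite invr_gt0 mulr_gt0.
have Ceta : C ^+ 2 * eta = 1 / 8 by rewrite /eta; field; rewrite gt_eqF.
(* A weight gap above [Om] puts [K1] and [K2] more than [r] apart, so [S] has no entries from [K2]
   to [K1]. The product on the left, an instance of the rank one action of [T], is thus pure
   approximation error. *)
have separated (K1 K2 : pred nat) y : (forall k, K1 k -> B k) -> (forall k, K2 k -> B k) ->
    (forall k m, K1 k -> K2 m -> Om * w k < w m) ->
    rnorm (phi x (proj b K2 y)) * rnorm (proj b K1 (u x)) <= eta ^+ 2 * rnorm y.
  move=> K1B K2B K12.
  have KB (K : pred nat) z : (forall k, K k -> B k) -> proj b K (proj b B z) = proj b K z.
    move=> KB; rewrite (projI fF); apply: (eq_proj fF) => k /=.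
    by case: (boolP (K k)) => //= /KB ->.
  have BK (K : pred nat) z : (forall k, K k -> B k) -> proj b B (proj b K z) = proj b K z.
    move=> KB'; rewrite (projI fF); apply: (eq_proj fF) => k /=.
    by case: (boolP (K k)) => [/KB' ->//|]; rewrite andbF.
  have -> : rnorm (phi x (proj b K2 y)) * rnorm (proj b K1 (u x)) =
      rnorm (proj b K1 (T (proj b K2 y) - S (proj b K2 y))).
    rewrite (blB (bl_proj fF _)) -rnormZ -[in T _](BK K2 y K2B) TB BK//.
    rewrite (blZ (bl_proj fF _)) KB//; congr rnorm.
    suff -> : proj b K1 (S (proj b K2 y)) = 0 by rewrite subr0.
    apply: (bl_vanish fF (A := proj b K1 \o (S \o proj b K2))).
      by apply: bl_comp; [exact: (bl_proj fF)|apply: bl_comp => //; exact: (bl_proj fF)].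
    move=> m; right; rewrite /= (proj_basis fF); case: ifPn => K2m; last first.
      by rewrite (bl0 blS) (bl0 (bl_proj fF _)).
    apply: (coord_inj fF) => k; rewrite (projE fF) (coord0 fF); case: ifPn => // K1k.
    apply: rS; rewrite ltNge; apply/negP => /Omw; rewrite leNgt.
    by rewrite K12.
  rewrite (le_trans (proj_le fF _ _))//.
  rewrite (le_trans (ler_wpM2l (ltW C0) (TS _)))//.
  have -> : eta ^+ 2 * rnorm y = C * (eta ^+ 2 / C ^+ 2 * (C * rnorm y)).
    by field; rewrite gt_eqF.
  have e0' : 0 <= eta ^+ 2 / C ^+ 2 by rewrite ltW// divr_gt0// exprn_gt0.
  by apply: ler_wpM2l; [exact: ltW|apply: ler_wpM2l => //; exact: (proj_le fF)].
have BN k : B k -> (k < N')%N by rewrite /B /block => /andP[].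
(* [w k0] is a level at which the low-weight part of [u x] reaches norm [eta]. Strictly below it the
   vector is too small to matter, as [C ^+ 2 * eta = 1 / 8]. Above [Om * w k0] the functional is
   small, by [separated] against a vector of norm at least [eta]. *)
have [||k0 [Bk0 /= Qle Qlt]] := @weight_threshold _ w
    (fun K => eta <= rnorm (proj b K (u x))) N' B BN.
- rewrite -(ler_pM2l C20) Ceta expr2.
  rewrite (le_trans _ (phi_le x _))//; lra.
- apply/negP; rewrite -ltNge (_ : proj b xpred0 (u x) = 0) ?rnorm0//.
  by apply: (coord_inj fF) => k; rewrite (projE fF) (coord0 fF).
pose Klo j := B j && (w j < w k0).
pose Khi j := B j && (Om * w k0 < w j).
pose S0 j := [&& B j, w k0 <= w j & w j <= Om * w k0].
have wk0 : w k0 <= Om * w k0 by rewrite ler_peMl// ltW.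
have lo : rnorm (phi x (proj b Klo (u x))) <= 1 / 8.
  rewrite (le_trans (phi_le _ _))// -expr2 -Ceta ler_wpM2l// ?ltW//.
  by move/negP: Qlt; rewrite -ltNge.
have hi : rnorm (phi x (proj b Khi (u x))) <= 1 / 8.
  have := @separated (fun j => B j && (w j <= w k0)) Khi (u x).
  move=> H; rewrite -Ceta; apply: (@le_trans _ _ (eta * C)); last first.
    by rewrite mulrC ler_wpM2r ?(ltW eta0)// ler_eXnr.
  rewrite -(ler_pM2r eta0).
  apply: (@le_trans _ _ (rnorm (phi x (proj b Khi (u x))) *
      rnorm (proj b (fun j => B j && (w j <= w k0)) (u x)))).
    by rewrite ler_wpM2l// rnorm_ge0.
  apply: (@le_trans _ _ (eta ^+ 2 * rnorm (u x))).
    apply: H => [k /andP[]//|k /andP[]//|k m /andP[_ kk0] /andP[_]].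
    by apply: le_lt_trans; rewrite ler_wpM2l//; lra.
  by rewrite expr2 mulrAC ler_wpM2r ?(ltW eta0)// ler_wpM2l ?(ltW eta0).
have split3 : phi x (proj b B (u x)) = phi x (proj b S0 (u x)) +
    (phi x (proj b Klo (u x)) + phi x (proj b Khi (u x))).
  rewrite -!phiD; congr phi; apply: (coord_inj fF) => k.
  rewrite !(coordD fF) !(projE fF) /S0 /Klo /Khi; case: (B k) => /=; last by rewrite !addr0.
  have [k0k|kk0] := leP (w k0) (w k); have [kO|Ok] := leP (w k) (Om * w k0) => /=;
    rewrite ?addr0 ?add0r//.
  by exfalso; lra.
(* On [S1] the vector has coordinates at most [eps]; on [S2] it has not, so the diagonal bound
   [eps ^+ 2] makes the functional at most [eps] there. *)
pose S1 j := S0 j && (rnorm (b j (u x)) <= eps).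
pose S2 j := S0 j && ~~ (rnorm (b j (u x)) <= eps).
have split2 : phi x (proj b S0 (u x)) = phi x (proj b S1 (u x)) + phi x (proj b S2 (u x)).
  rewrite -phiD; congr phi; apply: (coord_inj fF) => k.
  rewrite (coordD fF) !(projE fF) /S1 /S2; case: (S0 k); case: (_ <= eps) => //=;
    by rewrite ?addr0 ?add0r.
have S0w k m : S0 k -> S0 m -> w m <= Om * w k.
  move=> /and3P[_ k0k _] /and3P[_ _ /le_trans]; apply.
  by rewrite ler_wpM2l//; lra.
(* At least [3 / 4 - 2 / 8 = 1 / 2] of the pairing is left on [S0], and one of the two halves
   carries at least half of it. *)
have big : 1 / 4 <= rnorm (phi x (proj b S1 (u x))) \/
           1 / 4 <= rnorm (phi x (proj b S2 (u x))).
  have := rnormD (phi x (proj b Klo (u x))) (phi x (proj b Khi (u x))).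
  have := rnormD (phi x (proj b S0 (u x)))
    (phi x (proj b Klo (u x)) + phi x (proj b Khi (u x))).
  have := rnormD (phi x (proj b S1 (u x))) (phi x (proj b S2 (u x))).
  rewrite -split3 -split2 => i1 i2 i3.
  by have [|l1] := leP (1 / 4) (rnorm (phi x (proj b S1 (u x)))); [left|right; lra].
have bu k : rnorm (b k (u x)) <= C ^+ 2.
  by rewrite (le_trans (coord_le fF _ _))// expr2 ler_wpM2l ?(ltW C0).
have pf m : rnorm (phi x (f m)) <= C ^+ 2.
  by rewrite (le_trans (phi_le _ _))// (frame_norm fF) mulr1 expr2.
case: big => big; [exists S1|exists S2]; split=> //.
- by move=> k /andP[/and3P[]].
- by move=> k m /andP[S0k _] /andP[S0m _]; exact: S0w.
- move=> k m /andP[_ ke] _.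
  by rewrite [leRHS]mulrC ler_pM ?rnorm_ge0.
- by move=> k /andP[/and3P[]].
- by move=> k m /andP[S0k _] /andP[S0m _]; exact: S0w.
- move=> k m _ /andP[_]; rewrite -ltNge => em.
  apply: ler_pM; rewrite ?rnorm_ge0// leNgt; apply/negP => em'.
  have := diag m; rewrite rnormM expr2 leNgt => /negP; apply.
  by apply: ltr_pM; rewrite ?ltW.
Qed.

Lemma good_blockW eps eps' N N' x : 0 <= eps -> eps <= eps' ->
  good_block eps N N' x -> good_block eps' N N' x.
Proof.
move=> e0 ee' [h1 h2 h3 h4 h5]; split.
- exact: le_trans h1 ee'.
- exact: le_trans h2 ee'.
- by move=> y; rewrite (le_trans (h3 y))// ler_wpM2r// rnorm_ge0.
- by move=> y; rewrite (le_trans (h4 y))// ler_wpM2r// rnorm_ge0.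
- move=> k; rewrite (le_trans (h5 k))// !expr2.
  by apply: ler_pM.
Qed.

(** The hypothesis on ghosts in normalised coordinates: the factor [w n / w m] restores the entries
    with respect to the original basis. *)
Hypothesis ghosts_compact : forall p, roe del f b p -> p \o p = p ->
  (forall eps : R, 0 < eps -> exists n0, forall n m, (n0 <= n)%N -> (n0 <= m)%N ->
     rnorm (b m (p (f n))) * w n / w m <= eps) ->
  forall eps : R, 0 < eps -> exists N T,
    [/\ bl T, forall k, (N <= k)%N -> T (f k) = 0 &
        forall y, rnorm (p y - T y) <= eps * rnorm y].

Lemma diagonal_not_small : False.
Proof.
have C20 : 0 < C ^+ 2 by rewrite exprn_gt0.
have blphi x : bl (phi x : F -> (R[i])^o) by exact: bounded_by_bl (fphi x).
pose eps0 := (8 * C ^+ 2)^-1.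
have eps00 : 0 < eps0 by rewrite invr_gt0 mulr_gt0.
pose eps n := eps0 * 2 ^- n.+1.
have eps_gt0 n : 0 < eps n by rewrite mulr_gt0// half_pow_gt0.
have epsW m n : (m <= n)%N -> eps n <= eps m.
  by move=> mn; rewrite /eps ler_pM2l// half_pow_le.
have eps_le n : eps n <= eps0.
  by rewrite ler_piMr ?(ltW eps00)// invf_le1 ?exprn_gt0// exprn_ege1// ler1n.
have step M : exists z : nat * nat, (M <= z.1)%N /\
    forall K, (z.2 <= K)%N -> good_block (eps M) M K z.1.
  by have [x [K [Mx xK]]] := block_step M (eps_gt0 M); exists (x, K).
have [N [z Hz]] := dependent_sequence (fun z => maxn z.1.+1 z.2) step.
have NS i : (N i < N i.+1)%N by case: (Hz i).
have iN := increasing_geq_id NS; have NSS := increasing_leq NS.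
pose x i := (z i).1.
have xlt i j : (i < j)%N -> (x i < x j)%N.
  move=> ij; case: (Hz i) => _ _; rewrite geq_max => /andP[xi _].
  case: (Hz j) => -[xj _] _ _.
  by rewrite (leq_trans xi)// (leq_trans (NSS _ _ ij)).
have gb i : good_block (eps i) (N i) (N i.+1) (x i).
  case: (Hz i) => -[_ h] _; rewrite geq_max => /andP[_ /h].
  by apply: good_blockW; [exact: ltW|exact: epsW].
pose B i := block (N i) (N i.+1).
have NN i : (N i <= N i.+1)%N by exact: ltnW.
have Bdisj i j k : B i k -> B j k -> i = j.
  rewrite /B /block => /andP[ik ki] /andP[jk kj].
  by have [/NSS|/NSS|//] := ltngtP i j; lia.
pose ub i := proj b (B i) (u (x i)).
pose phib i := phi (x i) \o proj b (B i).
(* The error of cutting the [i]-th idempotent down to its block; these errors are summable in norm,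
   so their sum [T1] lies in the Roe algebra. *)
pose rest i := rank1 (u (x i)) (phi (x i)) - rank1 (ub i) (phib i).
have CC0 : 0 <= C * C by rewrite mulr_ge0// ltW.
have fphib i : functional (C * C * C) (phib i).
  by apply: functional_comp (proj_bound fF _).
have roe_rest i : roe del f b (rest i).
  apply: (roe_sub fF); first exact: (roe_rank1 delm fF _ (fphi (x i)) (shV (x i))).
  apply: (roe_rank1 delm fF _ (fphib i)).
  exact: (shrinking_proj fF (B i) (shV (x i))).
have rest_le i y : rnorm (rest i y) <= 4 * C ^+ 3 * eps0 * 2 ^- i.+1 * rnorm y.
  by have := block_compression y (eps_gt0 i) (NN i) (gb i); rewrite /eps mulrA.
have [T1 roeT1 T1cv] := roe_series fF roe_rest rest_le.
pose A : pred nat := fun j => `[< exists i, j = x i >].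
(* The sum of the cut-down blocks converges only pointwise. It lies in the Roe algebra as a
   difference: the image of the projection onto the [e (x i)], minus the errors. *)
pose T := U \o proj c A \o V - T1.
have roeT : roe del f b T.
  by apply: (roe_sub fF) => //; apply: UV; exact: (roe_proj dm fE).
have Tcv y : (fun M => \sum_(n < M) phib n y *: ub n) @ \oo --> T y.
  have h := bl_cvg blU (@sparse_expansion _ _ _ _ _ fE x (V y) xlt).
  rewrite (_ : (fun M => _) = fun M =>
    U (\sum_(n < M) c (x n) (V y) *: e (x n)) - \sum_(n < M) rest n y).
    exact: cvgB h (T1cv y).
  apply/funext => M; rewrite (bl_sum blU) -sumrB; apply: eq_bigr => n _.
  by rewrite (blZ blU) /rest !fctE /rank1 opprB addrCA subrr addr0.
have TB i y : T (proj b (B i) y) = phib i y *: ub i.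
  apply: cvg_rnorm_unique (Tcv _) _; apply/cvg_rnormP => eta eta0.
  exists i.+1 => M iM; rewrite (bigD1 (Ordinal iM))//= big1 => [|n ni].
    rewrite /phib /= (projI fF) addr0 (eq_proj fF _ (T := B i)) ?subrr ?rnorm0//.
    by move=> k /=; rewrite andbb.
  rewrite /phib /= (projI fF) (_ : proj b _ y = 0) ?(bl0 (blphi _)) ?scale0r//.
  apply: (coord_inj fF) => k; rewrite (projE fF) (coord0 fF); case: ifPn => //= /andP[nk ik].
  by case/eqP: ni; apply/val_inj; exact: Bdisj nk ik.
have blT := roe_bl roeT.
have eta0 : 0 < eps0 ^+ 2 / C ^+ 2 by rewrite divr_gt0// exprn_gt0.
have [_ /(_ _ eta0)[r [S [bandS TS]]]] := roeT.
have [Om Om1 Omw] := w_coarse r.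
have /choice[W HW] i : exists W : pred nat,
    [/\ forall k, W k -> B i k, forall k m, W k -> W m -> w m <= Om * w k,
        forall k m, W k -> W m ->
          rnorm (b k (u (x i))) * rnorm (phi (x i) (f m)) <= C ^+ 2 * eps i &
        1 / 4 <= rnorm (phi (x i) (proj b W (u (x i))))].
  apply: (block_window blT _ Om1 Omw (eps_gt0 i) (eps_le i) (NN i) (gb i)).
    by exists S.
  by move=> y; rewrite TB.
pose lam i := phi (x i) (proj b (W i) (u (x i))).
have lam4 i : 1 / 4 <= rnorm (lam i) by case: (HW i).
have lam0 i : lam i != 0 by rewrite -rnorm_gt0; have := lam4 i; lra.
have WB i k : W i k -> B i k by case: (HW i) => h _ _ _; exact: h.
have Wdisj i j k : W i k -> W j k -> i = j by move=> /WB Bi /WB; exact: Bdisj.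
pose Wall : pred nat := fun k => `[< exists i, W i k >].
have lamV i : rnorm (lam i)^-1 <= 4.
  rewrite rnormV -[4]invrK lef_pV2 ?posrE ?rnorm_gt0// ?invr_gt0//.
  by have := lam4 i; lra.
(* After the cut to [W i] the vector and the functional pair to [lam i]; the diagonal operator with
   value [(lam i)^-1] on [W i] brings this back to 1. *)
have /choice[t Ht] k : exists v : R[i], [/\ forall i, W i k -> v = (lam i)^-1,
    ~ (exists i, W i k) -> v = 0 & rnorm v <= 4].
  have [[i Wik]|nW] := pselect (exists i, W i k).
    exists (lam i)^-1; split=> // [j /(Wdisj _ _ _ Wik) ->//|[]]; by exists i.
  exists 0; split=> // [i Wik|]; last by rewrite rnorm0.
  by case: nW; exists i.
have tW i k : W i k -> t k = (lam i)^-1 by case: (Ht k) => h _ _; exact: h.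
have t0 k : ~ (exists i, W i k) -> t k = 0 by case: (Ht k).
have t4 k : rnorm (t k) <= 4 by case: (Ht k).
pose s i := proj b (W i) (u (x i)).
pose q := proj b Wall \o (T \o diagop b t).
have roeq : roe del f b q.
  apply: (roe_comp delm fF); first exact: (roe_proj delm fF).
  by apply: (roe_comp delm fF) => //; exact: (roe_diagop delm fF t4).
have blq := roe_bl roeq.
have projWub i : proj b Wall (ub i) = s i.
  rewrite /ub (projI fF); apply: (eq_proj fF) => k /=.
  apply/andP/idP => [[/asboolP[j Wjk] Bik]|Wik].
    by rewrite -(Bdisj _ _ _ (WB _ _ Wjk) Bik).
  by split; [apply/asboolP; exists i|exact: WB].
have BW i y : (forall k, ~~ W i k -> b k y = 0) -> proj b (B i) y = y.
  move=> Wy; apply: (coord_inj fF) => k; rewrite (projE fF); case: ifPn => // nB.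
  by rewrite Wy//; apply: contra nB; exact: WB.
have qW i y : (forall k, ~~ W i k -> b k y = 0) ->
    q y = ((lam i)^-1 * phi (x i) y) *: s i.
  move=> Wy.
  have ty : diagop b t y = (lam i)^-1 *: y.
    apply: (coord_inj fF) => k; rewrite (diagopE fF _ _ t4) (coordZ fF).
    by case: (boolP (W i k)) => [/tW ->//|/Wy ->]; rewrite !mulr0.
  rewrite /q /= ty (blZ blT) -{1}(BW i y Wy) TB /phib /= (BW i y Wy) scalerA.
  by rewrite (blZ (bl_proj fF _)) projWub.
have qf i m : W i m -> q (f m) = ((lam i)^-1 * phi (x i) (f m)) *: s i.
  move=> Wim; apply: qW => k Wik; rewrite (frame_delta fF).
  by rewrite (_ : k == m = false)//; apply: contraNF Wik => /eqP ->.
have qs i : q (s i) = s i.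
  rewrite (qW i) => [|k /negbTE Wik]; last by rewrite (projE fF) Wik.
  by rewrite mulVf ?scale1r.
have qf0 m : ~ (exists i, W i m) -> q (f m) = 0.
  move=> nW; rewrite /q /= (diagop_basis fF _ t4) t0// scale0r.
  by rewrite (bl0 blT) (bl0 (bl_proj fF _)).
have qq : q \o q = q.
  apply: (bl_eq_basis fF (bl_comp blq blq) blq) => m /=.
  have [[i Wim]|nW] := pselect (exists i, W i m).
    by rewrite !(qf _ _ Wim) (blZ blq) qs.
  by rewrite !qf0// (bl0 blq).
(* Entries between different windows vanish. Inside [W i] the product of the factors is at most a
   multiple of [eps i], and the ratio of weights is at most [Om]. *)
have qghost (eta : R) : 0 < eta -> exists n0, forall n m, (n0 <= n)%N -> (n0 <= m)%N ->
    rnorm (b m (q (f n))) * w n / w m <= eta.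
  move=> eta1; have [i0 Hi0] := half_pow_cvg0 (4 * (C ^+ 2 * eps0) * Om) eta1.
  exists (N i0) => n m Nn _.
  have [[i Win]|nW] := pselect (exists i, W i n); last first.
    by rewrite qf0// (coord0 fF) rnorm0 !mul0r ltW.
  rewrite (qf _ _ Win) (coordZ fF) /s (projE fF); case: ifPn => Wim; last first.
    by rewrite mulr0 rnorm0 !mul0r ltW.
  have i0i : (i0 <= i)%N.
    rewrite leqNgt; apply/negP => /NSS Nii0; have /andP[_] := WB _ _ Win.
    by rewrite ltnNge (leq_trans Nii0 Nn).
  have [_ h1 h2 _] := HW i.
  have wnm : w n / w m <= Om by rewrite ler_pdivrMr// h1.
  have bphi := h2 _ _ Wim Win.
  rewrite !rnormM (_ : _ * w n / w m = rnorm (lam i)^-1 *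
    (rnorm (b m (u (x i))) * rnorm (phi (x i) (f n))) * (w n / w m)); last by ring.
  have ent : rnorm (lam i)^-1 * (rnorm (b m (u (x i))) * rnorm (phi (x i) (f n)))
      <= 4 * (C ^+ 2 * eps i) by apply: ler_pM; rewrite ?mulr_ge0 ?rnorm_ge0.
  have wnm0 : 0 <= w n / w m by rewrite divr_ge0// ltW.
  have ent0 : 0 <= rnorm (lam i)^-1 * (rnorm (b m (u (x i))) * rnorm (phi (x i) (f n))).
    by rewrite !mulr_ge0 ?rnorm_ge0.
  rewrite (le_trans (ler_pM ent0 wnm0 ent wnm))// (le_trans _ (ltW Hi0))//.
  rewrite /eps (_ : 4 * (C ^+ 2 * (eps0 * 2 ^- i.+1)) * Om =
    4 * (C ^+ 2 * eps0) * Om * 2 ^- i.+1); last by ring.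
  apply: ler_wpM2l; last exact: half_pow_le (leqW i0i).
  have Om0 : 0 <= Om by lra.
  by apply: mulr_ge0 => //; apply: mulr_ge0 => //; apply: mulr_ge0; exact: ltW.
(* The block of index [N0] starts at [N N0 >= N0], so [T'] kills [s N0], which [q] fixes.
   Approximation within [1 / 2] then gives [s N0 = 0], against [lam N0 != 0]. *)
have [] := ghosts_compact roeq qq qghost (eps := 1 / 2); first lra.
move=> N0 [T' [blT' T'0 T'q]].
have Ts : T' (s N0) = 0.
  apply: (bl_vanish fF blT') => k; rewrite (projE fF); case: ifPn => [Wk|]; last by left.
  right; apply: T'0; have := WB _ _ Wk; rewrite /B /block => /andP[+ _].
  exact: leq_trans (iN N0).
have := T'q (s N0); rewrite Ts subr0 qs => h.
have := lam0 N0; rewrite /lam -/(s N0) (_ : s N0 = 0) ?(bl0 (blphi _)) ?eqxx//.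
by apply/eqP; rewrite -rnorm_eq0; have := rnorm_ge0 (s N0); lra.
Qed.

End GhostBlocks.

(** * From symmetric bases to normalised ones *)

Section OrderedScalars.
Context {R : realType}.

Lemma complex_ge1 (z : R[i]) : 1 <= z -> exists2 r : R, 1 <= r & z = r%:C.
Proof.
move=> z1; have /complex_gt0[r r0 zr] : 0 < z by exact: lt_le_trans z1.
by exists r => //; rewrite -lecR -zr.
Qed.

End OrderedScalars.

Section FrameW.
Context {R : realType} {E : completeNormedModType R[i]}.

Lemma frameW (e : nat -> E) (c : nat -> E -> R[i]) (C C' : R) :
  C <= C' -> frame e c C -> frame e c C'.
Proof.
move=> CC' [h1 h2 h3 h4 h5]; split=> // [n|t B tB]; first exact: bounded_byW (h2 n).
have [D DB DE] := h4 _ _ tB; exists D => //; apply: bounded_byW DB.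
by rewrite ler_wpM2r// (le_trans (rnorm_ge0 _) (tB 0%N)).
Qed.

End FrameW.

Section SchauderBasis.
Context {R : realType} {E : completeNormedModType R[i]}.
Context {e : nat -> E} (he : schauder_basis e).

Lemma biorthP x : (fun N => \sum_(i < N) biorth e i x *: e i) @ \oo --> x.
Proof.
have [a [ax _]] := he x.
have := @xgetI _ (fun=> 0) [set a : nat -> R[i] | series (fun n => a n *: e n) @ \oo --> x] a ax.
by rewrite /= seriesEord.
Qed.
Arguments biorthP : clear implicits.

Lemma biorth_unique x (a : nat -> R[i]) :
  (fun N => \sum_(i < N) a i *: e i) @ \oo --> x -> forall n, biorth e n x = a n.
Proof.
move=> ax n; have [a0 [_ a0u]] := he x.
have h1 := biorthP x.
have <- : a0 = a by apply: a0u; rewrite seriesEord.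
have -> // : a0 = fun n => biorth e n x by apply: a0u; rewrite seriesEord.
Qed.

Lemma biorth_lin n k x y : biorth e n (k *: x + y) = k * biorth e n x + biorth e n y.
Proof.
apply: (biorth_unique (a := fun n => k * biorth e n x + biorth e n y)).
rewrite (_ : (fun N => _) = fun N =>
   k *: (\sum_(i < N) biorth e i x *: e i) + \sum_(i < N) biorth e i y *: e i).
  by apply: cvgD; [apply: cvgZr|]; exact: biorthP.
apply/funext => N; rewrite scaler_sumr -big_split; apply: eq_bigr => i _ /=.
by rewrite scalerDl scalerA.
Qed.

Lemma biorth_delta m n : biorth e m (e n) = (m == n)%:R.
Proof.
apply: (biorth_unique (a := fun m => (m == n)%:R)).
apply/cvg_rnormP => eps e0; exists n.+1 => N nN.
rewrite (bigD1 (Ordinal nN))//= eqxx scale1r big1 ?addr0 ?subrr ?rnorm0// => i ni.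
rewrite (_ : nat_of_ord i == n = false) ?scale0r//.
by apply: contraNF ni => /eqP ni; apply/eqP/val_inj.
Qed.

Lemma biorth0 m : biorth e m 0 = 0.
Proof. by have := biorth_lin m (-1) 0 0; rewrite scaler0 addr0 mulN1r addNr. Qed.

Lemma biorthZ m k x : biorth e m (k *: x) = k * biorth e m x.
Proof. by have := biorth_lin m k x 0; rewrite biorth0 !addr0. Qed.

Lemma basis_neq0 n : e n != 0.
Proof.
apply/eqP => en; have := biorth_delta n n; rewrite en biorth0 eqxx => /esym/eqP.
by rewrite oner_eq0.
Qed.

Lemma biorth_inj x : (forall n, biorth e n x = 0) -> x = 0.
Proof.
move=> x0; apply: cvg_rnorm_unique (biorthP x) _; apply/cvg_rnormP => eps e0.
by exists 0%N => N _; rewrite big1 ?subrr ?rnorm0// => i _; rewrite x0 scale0r.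
Qed.

(** The inequality on finite sums carries the Cauchy property from the expansion of [x] to its
    image. The convergence is part of the conclusion so that coordinates of [T x] can be read
    off. *)
Lemma basis_extend (G : completeNormedModType R[i]) (g : nat -> G) (M : R) : 0 <= M ->
  (forall N (al : nat -> R[i]), rnorm (\sum_(n < N) al n *: g n)
     <= M * rnorm (\sum_(n < N) al n *: e n)) ->
  exists T : E -> G, [/\ bounded_by M T, forall n, T (e n) = g n &
    forall x, (fun N => \sum_(i < N) biorth e i x *: g i) @ \oo --> T x].
Proof.
move=> M0 gM.
have cv x : exists l : G, (fun N => \sum_(i < N) biorth e i x *: g i) @ \oo --> l.
  apply: cauchy_rnorm_cvg => eps e0.
  have M1 : 0 < M + 1 by lra.
  have e2 : 0 < eps / 2 / (M + 1) by rewrite !divr_gt0.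
  have /cvg_rnormP/(_ _ e2)[N HN] := biorthP x.
  exists N => m n Nm mn.
  (* With the first [m] coefficients erased, a difference of partial sums is itself a sum to which
     [gM] applies. *)
  pose al i : R[i] := if (i < m)%N then 0 else biorth e i x.
  have diffE (H : completeNormedModType R[i]) (h : nat -> H) :
      \sum_(i < n) biorth e i x *: h i - \sum_(i < m) biorth e i x *: h i =
      \sum_(i < n) al i *: h i.
    rewrite -!(big_mkord xpredT (fun i => biorth e i x *: h i)).
    rewrite -(big_mkord xpredT (fun i => al i *: h i)).
    rewrite (big_cat_nat (leq0n m) mn)/= [in RHS](big_cat_nat (leq0n m) mn)/=.
    rewrite addrAC subrr add0r (_ : \sum_(0 <= i < m) al i *: h i = 0).
      rewrite add0r; apply: eq_big_nat => i /andP[mi _].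
      by rewrite /al ltnNge mi.
    by rewrite big_nat big1// => i /andP[_ im]; rewrite /al im scale0r.
  rewrite diffE (le_lt_trans (gM n al))// -diffE.
  have : rnorm (\sum_(i < n) biorth e i x *: e i - \sum_(i < m) biorth e i x *: e i)
      <= eps / (M + 1).
    rewrite -(subrK x (\sum_(i < n) _)) -addrA (le_trans (rnormD _ _))//.
    rewrite rdistC; have := HN _ Nm; have := HN _ (leq_trans Nm mn).
    have -> : eps / (M + 1) = eps / 2 / (M + 1) + eps / 2 / (M + 1) by lra.
    lra.
  move=> /(ler_wpM2l M0)/le_lt_trans; apply.
  by rewrite mulrA ltr_pdivrMr// mulrDr mulr1 mulrC ltrDl.
pose T x := projT1 (cid (cv x)).
have Tcv x : (fun N => \sum_(i < N) biorth e i x *: g i) @ \oo --> T x.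
  exact: projT2 (cid (cv x)).
have linT : linear T.
  move=> k x y; apply: cvg_rnorm_unique (Tcv _) _.
  rewrite (_ : (fun N => _) = fun N =>
    k *: (\sum_(i < N) biorth e i x *: g i) + \sum_(i < N) biorth e i y *: g i).
    by apply: cvgD; [apply: cvgZr|]; exact: Tcv.
  apply/funext => N; rewrite scaler_sumr -big_split; apply: eq_bigr => i _ /=.
  by rewrite biorth_lin scalerDl scalerA.
exists T; split=> //.
- split=> // x; apply/ler_addgt0Pr => eps e0.
  have M1 : 0 < M + 1 by lra.
  have e2 : 0 < eps / (M + 1) by rewrite divr_gt0.
  have /cvg_rnormP/(_ _ e2)[N HN] := biorthP x.
  apply: (cvg_norm_le (Tcv x)) => n; exists (maxn n N); first exact: leq_maxl.
  rewrite (le_trans (gM _ (fun i => biorth e i x)))//.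
  set S := \sum_(i < _) _.
  have : rnorm S <= rnorm x + eps / (M + 1).
    rewrite -[S](subrK x) addrC (le_trans (rnormD _ _))// lerD2l rdistC ltW//.
    by apply: HN; exact: leq_maxr.
  move=> /(ler_wpM2l M0)/le_trans; apply; rewrite mulrDr lerD2l mulrA.
  by rewrite ler_pdivrMr// mulrDr mulr1 mulrC lerDl ltW.
- move=> n; apply: cvg_rnorm_unique (Tcv _) _.
  apply/cvg_rnormP => eps e0; exists n.+1 => N nN.
  rewrite (bigD1 (Ordinal nN))//= biorth_delta eqxx scale1r.
  rewrite big1 ?addr0 ?subrr ?rnorm0// => i ni; rewrite biorth_delta.
  rewrite (_ : nat_of_ord i == n = false) ?scale0r//.
  by apply: contraNF ni => /eqP ni; apply/eqP/val_inj.
Qed.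

Section Unconditional.
Context {lam : R} (lam1 : 1 <= lam).
Context (unc : forall N (al be : nat -> R[i]),
  (forall n, (n < N)%N -> rnorm (al n) <= rnorm (be n)) ->
  rnorm (\sum_(n < N) al n *: e n) <= lam * rnorm (\sum_(n < N) be n *: e n)).

Definition normalised (n : nat) : E := (rnorm (e n))^-1%:C *: e n.
Definition norm_coord (n : nat) (x : E) : R[i] := (rnorm (e n))%:C * biorth e n x.

Lemma norm_basis_gt0 n : 0 < rnorm (e n).
Proof. by rewrite rnorm_gt0 basis_neq0. Qed.

Lemma norm_basisC_neq0 n : (rnorm (e n))%:C != 0 :> R[i].
Proof. by rewrite (inj_eq (@complexI R) _ 0) gt_eqF// norm_basis_gt0. Qed.

Lemma norm_coordE n x : norm_coord n x *: normalised n = biorth e n x *: e n.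
Proof.
rewrite /norm_coord /normalised scalerA fmorphV /= mulrAC divff ?mul1r//.
exact: norm_basisC_neq0.
Qed.

(** The modulus of the [n]-th normalised coordinate is the norm of the [n]-th term of the expansion,
    which unconditionality bounds as a truncation. Multiplying coefficients by [t] is compared with
    scaling all of them by [B]. *)
Lemma frame_normalised : frame normalised norm_coord lam.
Proof.
have lam0 : 0 <= lam by exact: le_trans ler01 lam1.
split.
- move=> n; rewrite /normalised rnormZ rnorm_real ?invr_ge0 ?rnorm_ge0//.
  by rewrite mulVf// gt_eqF// norm_basis_gt0.
- move=> n; split=> [k x y|x].
    by rewrite /norm_coord biorth_lin mulrDr mulrCA.
  have E1 : rnorm (norm_coord n x) = rnorm (biorth e n x *: e n).
    by rewrite rnormZ mulrC /norm_coord rnormM rnorm_real// rnorm_ge0.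
  apply: (@le_trans _ _ (rnorm (biorth e n x *: e n))); first by rewrite -E1.
  apply/ler_addgt0Pr => eps e0.
  have lam0' : 0 < lam by exact: lt_le_trans ltr01 lam1.
  have /cvg_rnormP/(_ _ (divr_gt0 e0 lam0'))[N HN] := biorthP x.
  pose K := maxn N n.+1.
  pose al i : R[i] := if i == n then biorth e n x else 0.
  have nK : (n < K)%N by exact: leq_maxr.
  have alE : \sum_(i < K) al i *: e i = biorth e n x *: e n.
    rewrite (bigD1 (Ordinal nK))//= {1}/al eqxx big1 ?addr0// => i ni.
    rewrite /al (_ : nat_of_ord i == n = false) ?scale0r//.
    by apply: contraNF ni => /eqP ni; apply/eqP/val_inj.
  have al_le i : (i < K)%N -> rnorm (al i) <= rnorm (biorth e i x).
    by move=> _; rewrite /al; case: eqP => [->//|_]; rewrite rnorm0 rnorm_ge0.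
  rewrite -alE (le_trans (unc al_le))//.
  have : rnorm (\sum_(i < K) biorth e i x *: e i) <= rnorm x + eps / lam.
    rewrite -[\sum_(i < K) _](subrK x) addrC (le_trans (rnormD _ _))// lerD2l rdistC ltW//.
    by apply: HN; exact: leq_maxl.
  move=> /(ler_wpM2l lam0)/le_trans; apply.
  by rewrite mulrDr mulrCA divff ?mulr1// gt_eqF.
- move=> m n; rewrite /norm_coord /normalised biorthZ biorth_delta.
  have [->|_] := eqVneq m n; last by rewrite !mulr0.
  by rewrite mulr1 fmorphV /= divff// norm_basisC_neq0.
- move=> t B tB.
  have B0 : 0 <= B := le_trans (rnorm_ge0 _) (tB 0%N).
  have [|N al|D [DB _ Dcv]] := @basis_extend E (fun n => t n *: e n) (lam * B).
  + by rewrite mulr_ge0.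
  + under eq_bigr do rewrite scalerA.
    rewrite -mulrA -[B]rnorm_real// -rnormZ scaler_sumr.
    under [in leRHS]eq_bigr do rewrite scalerA.
    apply: (@unc N (fun n => al n * t n) (fun n => B%:C * al n)) => n _.
    by rewrite !rnormM rnorm_real// mulrC ler_wpM2r// rnorm_ge0.
  exists D => // n x; rewrite /norm_coord mulrCA; congr (_ * _).
  apply: (biorth_unique (a := fun n => t n * biorth e n x)).
  rewrite (_ : (fun N => _) = fun N => \sum_(i < N) biorth e i x *: (t i *: e i)).
    exact: Dcv.
  by apply/funext => N; apply: eq_bigr => i _; rewrite scalerA mulrC.
- move=> x; rewrite (_ : (fun N => _) = fun N => \sum_(i < N) biorth e i x *: e i).
    exact: biorthP.
  by apply/funext => N; apply: eq_bigr => i _; rewrite norm_coordE.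
Qed.

Lemma norm_coord_basis m k (a : E -> E) : bl a -> norm_coord m (a (normalised k)) =
  (rnorm (e m) / rnorm (e k))%:C * biorth e m (a (e k)).
Proof.
by move=> bla; rewrite /norm_coord /normalised (blZ bla) biorthZ rmorphM mulrA.
Qed.

Lemma norm_coord_basis_eq0 m k (a : E -> E) : bl a ->
  (norm_coord m (a (normalised k)) = 0) <-> (biorth e m (a (e k)) = 0).
Proof.
move=> bla; rewrite norm_coord_basis//; split=> [/eqP|->]; last by rewrite mulr0.
rewrite mulf_eq0 (inj_eq (@complexI R) _ 0) mulf_eq0 invr_eq0.
by rewrite !(gt_eqF (norm_basis_gt0 _))/= => /eqP.
Qed.

(** Propagation concerns only which entries vanish, and this is unaffected by rescaling the
    basis. *)
Lemma roe_normalised d a :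
  uniform_roe_algebra d e a <-> roe d normalised norm_coord a.
Proof.
rewrite /uniform_roe_algebra opclosureP; last by move=> b [/bounded_operatorsE].
split=> -[bla H]; split=> // eps /H.
  move=> [b [/bounded_operatorsE blb [r r0 rb]] ab]; exists r, b; split=> //.
  by split=> // n m /rb /norm_coord_basis_eq0; apply.
move=> [r [b [[blb rb] ab]]]; exists b => //; split; first exact/bounded_operatorsE.
(* [band_operators] asks for a positive radius, [band] does not. *)
exists (Num.max r 1); first by rewrite lt_max ltr01 orbT.
by move=> n m; rewrite gt_max => /andP[/rb /norm_coord_basis_eq0 h _]; exact: h.
Qed.

(** * Partial translations from symmetry of the basis *)

Section Symmetric.
Context {d : nat -> nat -> R} (dm : is_metric d) (d_ulf : uniformly_locally_finite d).
Context (e_sym : symmetric_basis d e).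

Lemma fsbig_bounded (G : completeNormedModType R[i]) (A : set nat) (g : nat -> G) N :
  (forall n, (N <= n)%N -> g n = 0) ->
  \sum_(n \in A) g n = \sum_(n < N) (if (n : nat) \in A then g n else 0).
Proof.
move=> gN; rewrite (fsbig_ord _ _ (fun n => if n \in A then g n else 0)).
rewrite -fsbig_mkcondl; apply/esym/fsbig_widen => [n []//|n [An nAN] /=].
by apply: gN; rewrite leqNgt; apply/negP => nN; apply: nAN.
Qed.

(** Symmetry compares the sums over [range y] with the translated ones; unconditionality bounds the
    restriction of a sum to [range y]. *)
Lemma raw_translations : translations d e.
Proof.
move=> r x y xinj yinj xyr.
have /choice[s Hs] n : exists k, (forall i, n = y i -> k = x i) /\
    ((forall i, n <> y i) -> k = 0%N).
  have [[i ->]|ny] := pselect (exists i, n = y i).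
    exists (x i); split=> [j /yinj ->//|H]; by have := H i.
  exists 0%N; split=> // i ni; by case: ny; exists i.
have sy i : s (y i) = x i by case: (Hs (y i)) => h _; exact: h.
pose A := range y; pose B := range x.
have bij : set_bij A B s.
  split.
  - by move=> _ [i _ <-]; rewrite sy; exists i.
  - move=> n m /set_mem[i _ <-] /set_mem[j _ <-]; by rewrite !sy => /xinj ->.
  - by move=> _ [i _ <-]; exists (y i); [exists i|rewrite sy].
have r0 : 0 < Num.max r 1 by rewrite lt_max ltr01 orbT.
have disp n : A n -> d n (s n) <= Num.max r 1.
  by move=> [i _ <-]; rewrite sy (metric_symmetric dm) le_max xyr.
have [_ /(_ _ r0 A B s bij disp)[C' /complex_gt0[M M0 ->] HM]] := e_sym.
pose g n := if n \in A then e (s n) else 0.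
have [|N al|T [TM Te _]] := @basis_extend E g (M * lam).
- by rewrite mulr_ge0 ?(ltW M0)// (le_trans ler01 lam1).
- pose al' n : R[i] := if (n < N)%N then al n else 0.
  have al'N n : (N <= n)%N -> al' n = 0 by rewrite /al' leqNgt => /negbTE ->.
  have fin : finite_set [set n | A n /\ al' n != 0].
    apply: (sub_finite_set _ (finite_II N)) => n [_ /=].
    by rewrite /al'; case: ltnP => //; rewrite eqxx.
  have /andP[_ h] := HM al' fin.
  rewrite !(@fsbig_bounded _ _ _ N) in h; try by move=> n /al'N ->; rewrite scale0r.
  move: h; rewrite !rnormE -rmorphM lecR => h.
  rewrite (_ : \sum_(n < N) al n *: g n =
    \sum_(n < N) (if (n : nat) \in A then al' n *: e (s n) else 0)); last first.
    by apply: eq_bigr => n _; rewrite /g /al' ltn_ord; case: ifP => //; rewrite scaler0.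
  rewrite (le_trans h)// -mulrA ler_wpM2l ?(ltW M0)//.
  rewrite (_ : \sum_(n < N) _ = \sum_(n < N) (if (n : nat) \in A then al n else 0) *: e n).
    apply: (@unc N (fun n => if n \in A then al n else 0) al) => n _.
    by case: ifP => // _; rewrite rnorm0 rnorm_ge0.
  apply: eq_bigr => n _; rewrite /al' ltn_ord; case: ifP => //; by rewrite scale0r.
exists T; split.
- exact: bounded_by_bl TM.
- by move=> i; rewrite Te /g sy ifT//; apply/mem_set; exists i.
- move=> n ny; rewrite Te /g ifF//; apply/negbTE/negP => /set_mem[i _ yi].
  exact: (ny i).
Qed.

(** Otherwise pairs at distance at most [r] with unbounded ratios of norms could be chosen along
    increasing indices, and the partial translation between them would be unbounded. *)
Lemma norm_basis_coarse r : exists2 Om, 1 <= Om &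
  forall k m, d k m <= r -> rnorm (e k) <= Om * rnorm (e m).
Proof.
apply: contrapT => Hno.
have large (Om : R) : 1 <= Om -> exists k m, d k m <= r /\ Om * rnorm (e m) < rnorm (e k).
  move=> Om1; apply: contrapT => Hs; apply: Hno; exists Om => // k m km.
  by rewrite leNgt; apply/negP => kOm; apply: Hs; exists k, m.
have w0 := norm_basis_gt0.
have step N : exists q : nat * nat, [/\ (N <= q.1)%N, (N <= q.2)%N, d q.1 q.2 <= r &
    N%:R * rnorm (e q.2) < rnorm (e q.1)].
  have [M HM] := ulf_bounded r N d_ulf.
  pose N' := maxn N M.
  (* [K] dominates every ratio of norms of indices below [N']. A larger ratio excludes that both
     indices are below [N'], hence by [HM] that either is below [N]. *)
  pose K := (\sum_(i < N') rnorm (e i)) * (\sum_(i < N') (rnorm (e i))^-1).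
  have K0 : 0 <= K.
    by apply: mulr_ge0; apply: sumr_ge0 => i _; rewrite ?invr_ge0 rnorm_ge0.
  have [|k [m [km kK]]] := large (1 + N%:R + K).
    by rewrite -addrA lerDl addr_ge0.
  have w0m := w0 m.
  have small : ~~ ((k < N') && (m < N'))%N.
    apply/negP => /andP[kN' mN']; move: kK; rewrite ltNge => /negP; apply.
    apply: (@le_trans _ _ (K * rnorm (e m))); last by rewrite ler_pM2r// lerDr addr_ge0.
    rewrite -ler_pdivrMr//; apply: ler_pM; rewrite ?invr_ge0 ?rnorm_ge0//.
      rewrite (bigD1 (Ordinal kN'))//= lerDl; by apply: sumr_ge0 => i _; exact: rnorm_ge0.
    rewrite (bigD1 (Ordinal mN'))//= lerDl.
    by apply: sumr_ge0 => i _; rewrite invr_ge0 rnorm_ge0.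
  have [kN mN] : (N <= k)%N /\ (N <= m)%N.
    split; rewrite leqNgt; apply/negP => lt; move/negP: small; apply; rewrite /N' !leq_max.
      by rewrite lt (HM _ _ lt km) orbT.
    by rewrite lt (HM m) ?orbT// (metric_symmetric dm).
  exists (k, m); split=> //=; apply: le_lt_trans kK.
  by rewrite ler_pM2r//; lra.
have [N [q Hq]] := dependent_sequence (fun q => maxn q.1.+1 q.2.+1) step.
have NS i : (N i < N i.+1)%N by case: (Hq i).
have iN := increasing_geq_id NS; have NSS := increasing_leq NS.
have qlt i j : (i < j)%N -> ((q i).1 < (q j).1)%N /\ ((q i).2 < (q j).2)%N.
  move=> ij; case: (Hq i) => _ _; case: (Hq j) => -[+ + _ _] _ _.
  by have := NSS _ _ ij; lia.
have xinj : injective (fun i => (q i).1) by apply: increasing_inj => i j /qlt[].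
have yinj : injective (fun i => (q i).2) by apply: increasing_inj => i j /qlt[].
have [|T [blT Ty _]] := raw_translations (r := r) xinj yinj.
  by move=> i; case: (Hq i) => -[].
have [M M1 [_ TM]] := bl_bound blT.
have [n Mn] := exists_nat_gt M.
case: (Hq n) => -[_ _ _ big] _ _.
have := TM (e (q n).2); rewrite Ty leNgt => /negP; apply; apply: le_lt_trans big.
rewrite ler_wpM2r ?rnorm_ge0// (le_trans (ltW Mn))// ler_nat; exact: iN.
Qed.

(** The translation of the original basis, corrected by a diagonal operator of norm ratios; these
    are bounded by [norm_basis_coarse]. *)
Lemma normalised_translations : translations d normalised.
Proof.
move=> r x y xinj yinj xyr.
have [T [blT Ty T0]] := raw_translations xinj yinj xyr.
have [Om Om1 OmH] := norm_basis_coarse r.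
pose rho i := rnorm (e (y i)) / rnorm (e (x i)).
have rho0 i : 0 <= rho i by rewrite divr_ge0// rnorm_ge0.
have /choice[t Ht] n : exists v : R[i], (forall i, n = y i -> v = (rho i)%:C) /\
    rnorm v <= Om.
  have [[i ->]|ny] := pselect (exists i, n = y i).
    exists (rho i)%:C; split=> [j /yinj ->//|].
    rewrite rnorm_real// ler_pdivrMr ?norm_basis_gt0// OmH//.
    by rewrite (metric_symmetric dm).
  exists 0; split=> [i ni|]; first by case: ny; exists i.
  by rewrite rnorm0; lra.
have tOm n : rnorm (t n) <= Om by case: (Ht n).
have ty i : t (y i) = (rho i)%:C by case: (Ht (y i)) => h _; exact: h.
exists (T \o diagop norm_coord t); split.
- apply: bl_comp => //.
  exact: bounded_by_bl (diagop_bound frame_normalised tOm).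
- move=> i /=; rewrite (diagop_basis frame_normalised _ tOm) ty (blZ blT).
  rewrite /normalised (blZ blT) Ty scalerA -rmorphM /=; congr (_%:C *: _).
  by rewrite /rho mulrAC divff ?mul1r// gt_eqF// norm_basis_gt0.
- move=> n ny; rewrite /= (diagop_basis frame_normalised _ tOm) (blZ blT).
  by rewrite /normalised (blZ blT) T0// !scaler0.
Qed.

End Symmetric.
End Unconditional.
End SchauderBasis.

Lemma unconditional_constant (R : realType) (E : completeNormedModType R[i])
    (e : nat -> E) : unconditional_basis e ->
  exists2 lam : R, 1 <= lam & forall N (al be : nat -> R[i]),
    (forall n, (n < N)%N -> rnorm (al n) <= rnorm (be n)) ->
    rnorm (\sum_(n < N) al n *: e n) <= lam * rnorm (\sum_(n < N) be n *: e n).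
Proof.
move=> [_ [_ /complex_ge1[lam lam1 ->] H]]; exists lam => // -[|N] al be albe.
  by rewrite !big_ord0 rnorm0 mulr0.
have := H N al be; rewrite !rnormE -rmorphM lecR; apply=> n nN.
by rewrite rnorm_le; exact: albe.
Qed.

(** * Hereditary embeddings *)

Section HereditaryEmbedding.
Context {R : realType} {E F : completeNormedModType R[i]}.
Context {d del : nat -> nat -> R} {e : nat -> E} {c : nat -> E -> R[i]}.
Context {f : nat -> F} {b : nat -> F -> R[i]} {C : R}.
Context (dm : is_metric d) (delm : is_metric del).
Context (fE : frame e c C) (fF : frame f b C).
Context {A : set (E -> E)} {B : set (F -> F)}.
Context (AE : forall a, A a <-> roe d e c a) (BE : forall a, B a <-> roe del f b a).

(* An embedding onto a hereditary subalgebra is spatially implemented: the image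
   of a rank one idempotent [e_0] is a rank one idempotent with range spanned by
   some [w0], and [U x = Phi (x (x) e_0^* ) w0] identifies [E] with the range of
   the idempotent [Phi 1]. *)
Lemma embedding_spatial Phi : banach_algebra_embedding A B Phi ->
  hereditary_subalgebra (Phi @` A) B ->
  exists (U : E -> F) (V : F -> E),
    [/\ bl U, bl V, forall x, V (U x) = x,
        forall a, roe d e c a -> roe del f b (U \o a \o V) &
        forall a, roe del f b a -> roe d e c (V \o a \o U)].
Proof.
move=> [PhiB PhiD PhiZ PhiM [K K0 PhiK] [k0 k00 Phik0]] [_ her].
have C1 := frame_const_ge1 fE; have C0 : 0 < C by lra.
have Abl a : A a -> bl a by move=> /AE/roe_bl.
have Pbl a : A a -> bl (Phi a) by move=> /PhiB/BE/roe_bl.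
have Phi_inj a a' : A a -> A a' -> Phi a = Phi a' -> a = a'.
  move=> Aa Aa' aa'.
  have AZ : A (-1 *: a') by apply/AE; apply: (roe_scale fE); exact/AE.
  have As : A (a + -1 *: a') by apply/AE; apply: (roe_add fE); exact/AE.
  have := Phik0 _ As; rewrite PhiD// PhiZ// aa' [X in _ <= opnorm (_ + X)]scaleN1r subrr => h.
  have n0 : opnorm (0 : F -> F) <= 0.
    apply: opnorm_le => //; first by rewrite -[0](subrr (Phi a)); apply: bl_sub; exact: Pbl.
    by move=> x; rewrite mul0r rnorm0.
  have {}h : opnorm (a + -1 *: a') <= 0 by have := le_trans h n0; rewrite pmulr_rle0.
  apply/funext => x; apply/eqP; rewrite -subr_eq0 -rnorm_eq0 eq_le rnorm_ge0 andbT.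
  have := opnorm_rnorm x (Abl _ As); rewrite !fctE scaleN1r => /le_trans; apply.
  by rewrite mulr_le0_ge0// rnorm_ge0.
pose E1 (x : E) := rank1 x (c 0%N).
have AE1 x : A (E1 x).
  by apply/AE; apply: (roe_rank1 dm fE x (functional_coord fE 0%N)); exact: (shrinking_coord fE).
have cE0 : c 0%N (e 0%N) = 1 by rewrite (frame_delta fE).
pose p0 := E1 (e 0%N); pose q0 := Phi p0.
have p0p0 : p0 \o p0 = p0.
  by apply/funext => x; rewrite /p0 /E1 /rank1 /= (coordZ fE) cE0 mulr1.
have Ap0 : A p0 := AE1 _.
have q0q0 y : q0 (q0 y) = q0 y.
  by rewrite /q0 -[in RHS]p0p0 PhiM.
have blq0 : bl q0 := Pbl _ Ap0.
have [z qz0] : exists z, q0 z != 0.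
  apply: contrapT => H.
  have q0E : q0 = Phi (0 *: p0).
    rewrite PhiZ// scale0r; apply/funext => z; apply: contrapT => /eqP z0.
    by apply: H; exists z.
  have A0 : A (0 *: p0) by apply/AE; apply: (roe_scale fE); exact/AE.
  have /(congr1 (fun a => a (e 0%N))) := Phi_inj _ _ Ap0 A0 q0E.
  rewrite scale0r /p0 /E1 /rank1 cE0 scale1r => e00.
  by have := frame_norm fE 0%N; rewrite e00 rnorm0 => /esym/eqP; rewrite oner_eq0.
pose w0 := q0 z.
have q0w0 : q0 w0 = w0 by exact: q0q0.
have w00 : 0 < rnorm w0 by rewrite rnorm_gt0.
have [m beta0] : exists m, b m w0 != 0.
  apply: contrapT => H; move/eqP: qz0; apply; apply: (coord_inj fF) => m.
  rewrite (coord0 fF); apply: contrapT => /eqP bm; apply: H; by exists m.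
(* Rank one operators with an arbitrary range vector [y], to be sandwiched between images of [Phi]
   so that heredity applies; [m] is such that they do not kill [w0]. *)
pose Ry (y : F) := rank1 y (b m).
have BRy y : B (Ry y).
  by apply/BE; apply: (roe_rank1 delm fF y (functional_coord fF m)); exact: (shrinking_coord fF).
have imPhi a : A a -> (Phi @` A) (Phi a) by exists a.
(* By heredity [q0 \o Ry y \o q0 = Phi a], and injectivity gives [a = p0 \o a \o p0], a multiple of
   [p0]. Evaluation at [w0] shows that [b m w0] times [q0 y] is a multiple of [w0]. *)
have rank_one y : exists g : R[i], q0 y = g *: w0.
  have [a Aa aE] := her _ _ _ (imPhi _ Ap0) (BRy y) (imPhi _ Ap0).
  have Aap : A (a \o p0) by apply/AE; apply: (roe_comp dm fE); exact/AE.
  have Apap : A (p0 \o (a \o p0)) by apply/AE; apply: (roe_comp dm fE); exact/AE.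
  have aE' : a = p0 \o (a \o p0).
    apply: Phi_inj => //; rewrite (PhiM p0 (a \o p0))// (PhiM a p0)// aE; apply/funext => t /=.
    by rewrite -/q0 !q0q0.
  have aP : a = c 0%N (a (e 0%N)) *: p0.
    rewrite [LHS]aE'; apply/funext => t; rewrite !fctE /p0 /E1 /rank1 /=.
    by rewrite (blZ (Abl _ Aa)) (coordZ fE) scalerA mulrC.
  have /(congr1 (fun h => h w0)) := aE; rewrite aP PhiZ// !fctE /= -/q0 q0w0.
  rewrite /Ry /rank1 (blZ blq0) => h.
  exists ((b m w0)^-1 * c 0%N (a (e 0%N))).
  by rewrite -scalerA h scalerA mulVf// scale1r.
have Aid : A idfun by apply/AE; exact: (roe_id dm fE).
pose P := Phi idfun.
have PhiP a y : A a -> Phi a (P y) = Phi a y.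
  by move=> Aa; rewrite -[LHS]/((Phi a \o P) y) -PhiM.
have blP : bl P := Pbl _ Aid.
pose U x := Phi (E1 x) w0.
have linU : linear U.
  move=> k x y; rewrite /U (_ : E1 (k *: x + y) = k *: E1 x + E1 y).
    rewrite PhiD// ?PhiZ//; last by apply/AE; apply: (roe_scale fE); exact/AE.
  by apply/funext => t; rewrite !fctE /E1 /rank1 scalerDr !scalerA mulrC.
have E1_le x : opnorm (E1 x) <= C * rnorm x.
  apply: opnorm_le; [exact: Abl|by rewrite mulr_ge0 ?rnorm_ge0// ltW|move=> t].
  by rewrite /E1 /rank1 rnormZ mulrAC ler_wpM2r ?rnorm_ge0// (coord_le fE).
have blU : bl U.
  exists (K * C * rnorm w0); split=> // x.
  rewrite (le_trans (opnorm_rnorm _ (Pbl _ (AE1 x))))// mulrAC ler_wpM2r ?rnorm_ge0//.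
  by rewrite (le_trans (PhiK _ (AE1 x)))// -mulrA ler_wpM2l// ltW.
have PhiU a x : A a -> Phi a (U x) = U (a x).
  move=> Aa; rewrite /U -[LHS]/((Phi a \o Phi (E1 x)) w0) -PhiM//; congr (Phi _ _).
  by apply/funext => t; rewrite /E1 /rank1 /= (blZ (Abl _ Aa)).
have PU x : P (U x) = U x by exact: PhiU.
(* [E1 x = E1 x \o p0] makes [Phi (E1 x)] factor through [q0], whose range is spanned by [w0]. Its
   norm is thus controlled by the value [U x] at [w0], and [Phi] is bounded below. *)
have U_below x : rnorm x <= opnorm q0 / rnorm w0 / k0 * rnorm (U x).
  have h1 : rnorm x <= opnorm (E1 x).
    have := opnorm_rnorm (e 0%N) (Abl _ (AE1 x)).
    by rewrite (frame_norm fE) mulr1 /E1 /rank1 cE0 scale1r.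
  have h2 : opnorm (Phi (E1 x)) <= opnorm q0 / rnorm w0 * rnorm (U x).
    have n0 : 0 <= opnorm q0 / rnorm w0 by rewrite divr_ge0 ?opnorm_ge0 ?rnorm_ge0.
    apply: opnorm_le; [exact: Pbl|by rewrite mulr_ge0// rnorm_ge0|move=> y].
    have -> : Phi (E1 x) y = Phi (E1 x) (q0 y).
      rewrite -[RHS]/((Phi (E1 x) \o Phi p0) y) -PhiM//; congr (Phi _ _).
      by apply/funext => t; rewrite /p0 /E1 /rank1 /= (coordZ fE) cE0 mulr1.
    have [g gE] := rank_one y.
    have := opnorm_rnorm y blq0; rewrite gE rnormZ -ler_pdivlMr// => h.
    rewrite (blZ (Pbl _ (AE1 x))) rnormZ mulrAC ler_wpM2r ?rnorm_ge0//.
    by rewrite (le_trans h)// mulrAC.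
  rewrite mulrAC ler_pdivlMr// mulrC (le_trans _ h2)// (le_trans _ (Phik0 _ (AE1 x)))//.
  by rewrite ler_wpM2l// ltW.
have U_inj x y : U x = U y -> x = y.
  move=> Uxy; apply/eqP; rewrite -subr_eq0 -rnorm_eq0 eq_le rnorm_ge0 andbT.
  by have := U_below (x - y); rewrite (blB blU) Uxy subrr rnorm0 mulr0.
(* By heredity [P \o Ry y \o q0 = Phi a], and [a = a \o p0] has the form [E1 v]. Evaluation at [w0]
   gives [U v = b m w0 *: P y]. *)
have U_surj y : exists x, U x = P y.
  have [a Aa aE] := her _ _ _ (imPhi _ Aid) (BRy y) (imPhi _ Ap0).
  have Aap : A (a \o p0) by apply/AE; apply: (roe_comp dm fE); exact/AE.
  have aE' : a = a \o p0.
    by apply: Phi_inj => //; rewrite (PhiM a p0)// aE; apply/funext => t /=; rewrite -/q0 q0q0.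
  have aE1 : a = E1 (a (e 0%N)).
    by rewrite [LHS]aE'; apply/funext => t; rewrite /p0 /E1 /rank1 /= (blZ (Abl _ Aa)).
  exists ((b m w0)^-1 *: a (e 0%N)).
  have aw : Phi a w0 = P (Ry y (q0 w0)) by rewrite aE.
  rewrite (blZ blU) {1}/U -aE1 aw q0w0 /Ry /rank1 (blZ blP).
  by rewrite scalerA mulVf// scale1r.
have [V UV] := choice U_surj.
have linV : linear V.
  by move=> k x y; apply: U_inj; rewrite linU !UV (blD blP) (blZ blP).
have VU x : V (U x) = x by apply: U_inj; rewrite UV PU.
exists U, V; split=> //.
- exists (opnorm q0 / rnorm w0 / k0 * opnorm P); split=> // y.
  rewrite (le_trans (U_below _))// UV -[leRHS]mulrA ler_wpM2l ?opnorm_rnorm//.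
  by rewrite !divr_ge0 ?opnorm_ge0 ?rnorm_ge0// ltW.
- move=> a /AE Aa; rewrite (_ : _ \o V = Phi a); first by apply/BE; exact: PhiB.
  by apply/funext => y; rewrite /= -PhiU// UV PhiP.
(* Heredity writes [P \o a \o P] as [Phi a'], and [a'] turns out to be [V \o a \o U]. *)
- move=> a /BE Ba; have [a' Aa' a'E] := her _ _ _ (imPhi _ Aid) Ba (imPhi _ Aid).
  rewrite (_ : _ \o U = a'); first exact/AE.
  apply/funext => x; apply: U_inj; rewrite /= UV -PhiU// a'E.
  by rewrite -[RHS]/(P (a (P (U x)))) PU.
Qed.

End HereditaryEmbedding.

(** * Coarse embeddings *)

Arguments normalised {R E} e n.
Arguments norm_coord {R E} e n x.

Section CoarseEmbedding.
Context {R : realType} {E F : completeNormedModType R[i]}.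
Context {d del : nat -> nat -> R} {e : nat -> E} {c : nat -> E -> R[i]}.
Context {f : nat -> F} {b : nat -> F -> R[i]} {C : R}.
Context (dm : is_metric d) (delm : is_metric del).
Context (d_ulf : uniformly_locally_finite d) (del_ulf : uniformly_locally_finite del).
Context (fE : frame e c C) (fF : frame f b C).
Context (trE : translations d e) (trF : translations del f).
Context {U : E -> F} {V : F -> E} (UC : bounded_by C U) (VC : bounded_by C V).
Context (UV : forall a, roe d e c a -> roe del f b (U \o a \o V)).
Context (VU : forall a, roe del f b a -> roe d e c (V \o a \o U)).

Lemma entry_le k m x y : rnorm (b k (U (e x)) * c y (V (f m))) <= C ^+ 4.
Proof.
have C0 : 0 <= C by have := frame_const_ge1 fE; lra.
have h1 : rnorm (b k (U (e x))) <= C ^+ 2.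
  rewrite (le_trans (coord_le fF _ _))// expr2 ler_wpM2l//.
  by have [_ /(_ (e x))] := UC; rewrite (frame_norm fE) mulr1.
have h2 : rnorm (c y (V (f m))) <= C ^+ 2.
  rewrite (le_trans (coord_le fE _ _))// expr2 ler_wpM2l//.
  by have [_ /(_ (f m))] := VC; rewrite (frame_norm fF) mulr1.
by rewrite rnormM (_ : 4 = 2 + 2)%N// exprD ler_pM ?rnorm_ge0.
Qed.

(** The entries of [e_(x,y)] at [(k x, k y)] and of [e_(y,x)] at [(k y, k x)] multiply to the
    product of two diagonal entries, at least [delta ^+ 2]. As each is at most [C ^+ 4], neither can
    be small. *)
Lemma coarse_embedding_of_diagonal (delta : R) (k : nat -> nat) : 0 < delta ->
  (forall x, delta <= rnorm (b (k x) (U (e x)) * c x (V (f (k x))))) ->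
  coarse_embedding d del k.
Proof.
move=> delta0 Hk; have C1 := frame_const_ge1 fE.
have C40 : 0 < C ^+ 4 by rewrite exprn_gt0//; lra.
have eta0 : 0 < delta ^+ 2 / C ^+ 4 by rewrite divr_gt0// exprn_gt0.
have cross x y : delta ^+ 2 / C ^+ 4 <= rnorm (b (k x) (U (e x)) * c y (V (f (k y)))).
  rewrite ler_pdivrMr//.
  apply: (@le_trans _ _ (rnorm (b (k x) (U (e x)) * c y (V (f (k y)))) *
      rnorm (b (k y) (U (e y)) * c x (V (f (k x)))))); last first.
    by rewrite ler_wpM2l ?rnorm_ge0// entry_le.
  have -> : rnorm (b (k x) (U (e x)) * c y (V (f (k y)))) *
      rnorm (b (k y) (U (e y)) * c x (V (f (k x)))) =
    rnorm (b (k x) (U (e x)) * c x (V (f (k x)))) *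
      rnorm (b (k y) (U (e y)) * c y (V (f (k y)))) by rewrite !rnormM; ring.
  by rewrite expr2 ler_pM// ltW.
split=> r r0.
  have [s Hs] := entries_controlled dm delm d_ulf fE fF trE UC UV r eta0.
  exists (s%:R + 1); first by rewrite ltr_pwDr.
  move=> x y /ltW xy; apply: (@le_lt_trans _ _ s%:R); last by rewrite ltrDl.
  exact: (Hs x y _ _ xy (cross x y)).
(* The same scalar is an entry of the image under [V] and [U] of a matrix unit of [F]. Controlling
   these gives the contrapositive of expansion. *)
have [s Hs] := entries_controlled delm dm del_ulf fF fE trF VC VU r eta0.
exists (s%:R + 1); first by rewrite ltr_pwDr.
move=> x y; apply: contraTT; rewrite -!leNgt => kxy.
apply: (@le_trans _ _ s%:R); last by rewrite lerDl.
apply: (Hs (k x) (k y) x y kxy).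
by rewrite /entry [c _ _ * _]mulrC.
Qed.

End CoarseEmbedding.

(** * Ghosts and compactness in normalised coordinates *)

Section GhostTranslation.
Context {R : realType} {F : completeNormedModType R[i]} {f : nat -> F}.
Context (f_basis : schauder_basis f).

Lemma biorth_norm_coord m n (p : F -> F) : bl p ->
  rnorm (biorth f m (p (f n))) =
  rnorm (norm_coord f m (p (normalised f n))) * rnorm (f n) / rnorm (f m).
Proof.
move=> blp; have w0 := norm_basis_gt0 f_basis.
rewrite (norm_coord_basis f_basis _ _ blp) rnormM rnorm_real; last first.
  by rewrite divr_ge0// rnorm_ge0.
by field; rewrite !gt_eqF ?w0.
Qed.

Lemma M_inftyP p : M_infty f p -> forall eps : R, 0 < eps -> exists N T,
  [/\ bl T, forall k, (N <= k)%N -> T (normalised f k) = 0 &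
      forall y, rnorm (p y - T y) <= eps * rnorm y].
Proof.
have M_bl T : (\bigcup_n M_fin f n) T -> bl T by move=> [N _ [/bounded_operatorsE]].
move=> /(opclosureP _ M_bl)[_ H] eps /H[T [N _ [/bounded_operatorsE blT T0]] pT].
(* [M_fin] retains the index [N] itself, hence the successor. *)
exists N.+1, T; split=> // k Nk; rewrite /normalised (blZ blT).
by rewrite (biorth_inj f_basis (x := T (f k))) ?scaler0// => m; apply: T0; right.
Qed.

Lemma ghost_normalised (p : F -> F) : bl p ->
  (forall eps : R, 0 < eps -> exists n0, forall n m, (n0 <= n)%N -> (n0 <= m)%N ->
     rnorm (norm_coord f m (p (normalised f n))) * rnorm (f n) / rnorm (f m) <= eps) ->
  ghost f p.
Proof.
move=> blp H; split; first exact/bounded_operatorsE.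
move=> _ /complex_gt0[eps /H[n0 Hn0] ->]; exists n0 => n m n0n n0m.
by rewrite rnormE lecR biorth_norm_coord// Hn0.
Qed.

End GhostTranslation.

Theorem theorem7p14 (R : realType) (d del : nat -> nat -> R)
  (E F : completeNormedModType (complex R)) (e : nat -> E) (f : nat -> F)
  (d_metric : is_metric d) (del_metric : is_metric del)
  (d_ulf : uniformly_locally_finite d)
  (del_ulf : uniformly_locally_finite del)
  (e_basis : schauder_basis e) (f_basis : schauder_basis f)
  (e_sym : symmetric_basis d e) (f_sym : symmetric_basis del f)
  (ghosts : forall p : F -> F,
     uniform_roe_algebra del f p -> ghost_idempotent f p -> M_infty f p)
  (embeds : embeds_onto_hereditary
     (uniform_roe_algebra d e) (uniform_roe_algebra del f)) :
  coarsely_embeds d del.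
Proof.
have [lamE lamE1 uncE] := unconditional_constant (proj1 e_sym).
have [lamF lamF1 uncF] := unconditional_constant (proj1 f_sym).
pose C0 := Num.max lamE lamF.
have frameE0 : frame (normalised e) (norm_coord e) C0.
  by apply: frameW (frame_normalised e_basis lamE1 uncE); rewrite le_max lexx.
have frameF0 : frame (normalised f) (norm_coord f) C0.
  by apply: frameW (frame_normalised f_basis lamF1 uncF); rewrite le_max lexx orbT.
have [Phi [emb her]] := embeds.
have [U [V [[MU UM] [MV VM] VU UaV VaU]]] := embedding_spatial d_metric del_metric
  frameE0 frameF0 (roe_normalised e_basis d) (roe_normalised f_basis del) emb her.
(* One constant for both frames and both operators, so that [E] with [U] and [F] with [V] can
   exchange roles. *)
pose C := Num.max C0 (Num.max MU MV).
have frameE : frame (normalised e) (norm_coord e) C.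
  by apply: frameW frameE0; rewrite le_max lexx.
have frameF : frame (normalised f) (norm_coord f) C.
  by apply: frameW frameF0; rewrite le_max lexx.
have UC : bounded_by C U by apply: bounded_byW UM; rewrite !le_max lexx !orbT.
have VC : bounded_by C V by apply: bounded_byW VM; rewrite !le_max lexx !orbT.
have trE := normalised_translations e_basis lamE1 uncE d_metric d_ulf e_sym.
have trF := normalised_translations f_basis lamF1 uncF del_metric del_ulf f_sym.
have e0 : normalised e 0%N != 0.
  by rewrite -rnorm_gt0 (frame_norm frameE).
have blV := bounded_by_bl VC.
have Ue0 : U (normalised e 0%N) != 0.
  by apply: contra_neq e0 => Ue0; rewrite -(VU (normalised e 0%N)) Ue0 (bl0 blV).
have shV x : shrinking (norm_coord f) (norm_coord e x \o V).
  apply: (shrinking_corner d_metric del_metric del_ulf frameE frameF UC UaV).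
  by exists (normalised e 0%N).
have shU k : shrinking (norm_coord e) (norm_coord f k \o U).
  apply: (shrinking_corner del_metric d_metric d_ulf frameF frameE VC VaU).
  by exists (U (normalised e 0%N)); rewrite VU.
have [delta delta0 Hdelta] : exists2 delta : R, 0 < delta & forall x, exists k,
    delta <= rnorm (norm_coord f k (U (normalised e x)) *
                    norm_coord e x (V (normalised f k))).
  apply: contrapT => Hno.
  apply: (diagonal_not_small d_metric del_metric frameE frameF UC VC UaV VU shV shU
    (norm_basis_gt0 f_basis)
    (norm_basis_coarse f_basis lamF1 uncF del_metric del_ulf f_sym)) => [delta delta0|p].
    apply: contrapT => Hx; apply: Hno; exists delta => // x.
    apply: contrapT => Hk; apply: Hx; exists x => k.
    by rewrite ltNge; apply/negP => h; apply: Hk; exists k.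
  move=> roep pp gp; apply: M_inftyP => //; apply: ghosts.
    exact/roe_normalised.
  by split=> //; apply: ghost_normalised gp => //; exact: roe_bl roep.
have [k Hk] := choice Hdelta.
exists k.
exact: (coarse_embedding_of_diagonal d_metric del_metric d_ulf del_ulf frameE frameF
  trE trF UC VC UaV VaU delta0 Hk).
Qed.
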